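(* Each of the following implications holds for every countable Borel equivalence relation $E$ on a standard Borel space $X$ (where $\mathsf{x}\rightarrow\mathsf{y}$ means: if $E$ has property $\mathsf{x}$ then $E$ has property $\mathsf{y}$): $$\mathsf{s}\rightarrow\mathsf{p},\quad \mathsf{p}\rightarrow\mathsf{t},\quad \mathsf{p}\rightarrow\mathsf{b},\quad \mathsf{p}\rightarrow\mathsf{a},\quad \mathsf{b}\rightarrow\mathsf{d},\quad \mathsf{b}\rightarrow\mathsf{r},\quad \mathsf{r}\rightarrow\mathsf{i},\quad \mathsf{r}\rightarrow\mathsf{u}.$$
   Context: A Borel equivalence relation on a standard Borel space is countable if all its classes are countable. If $E$, $F$ are equivalence relations on standard Borel spaces $X$, $Y$, a Borel homomorphism from $E$ to $F$, written $f\colon E\to F$, is a Borel function $f\colon X\to Y$ such that $x\mathrel{E}x'$ implies $f(x)\mathrel{F}f(x')$. $[\omega]^\omega$ is the set of infinite subsets of $\omega$, viewed as a Borel subset of $2^\omega$. $E_0(\omega^\omega)$ and $E_0([\omega]^\omega)$ denote eventual equality $=^*$ on $\omega^\omega$ (agreement at all but finitely many $n$) and on $[\omega]^\omega$ (finite symmetric difference). For $\alpha,\beta\in\omega^\omega$, $\alpha\leq^*\beta$ means $\alpha(n)\leq\beta(n)$ for all but finitely many $n$. $A\subset^*B$ means $A\smallsetminus B$ is finite, and $A^c=\omega\smallsetminus A$. For a standard Borel space $Z$, $E_{\mathsf{set}}(Z)$ is the equivalence relation on $Z^\omega$ given by $\langle z_n\rangle\mathrel{E_{\mathsf{set}}(Z)}\langle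 z_n'\rangle$ iff $\{z_n:n\in\omega\}=\{z'_n:n\in\omega\}$. A family $\mathcal F\subset[\omega]^\omega$ is centered if every finite subfamily has infinite intersection. It is almost disjoint if any two distinct members have finite intersection. It is independent if every intersection of finitely many members of $\mathcal F$ with the complements of finitely many other members of $\mathcal F$ is infinite. In the following definitions of properties of a countable Borel equivalence relation $E$ on $X$, $\phi$ and $\psi$ always denote Borel homomorphisms. - $\mathsf{b}$: for every $\phi\colon E\to E_{\mathsf{set}}(\omega^\omega)$ there is $\psi\colon E\to E_0(\omega^\omega)$ such that for all $x\in X$, $n\in\omega$, $\phi(x)(n)\leq^*\psi(x)$. - $\mathsf{d}$: for every $\phi\colon E\to E_{\mathsf{set}}(\omega^\omega)$ there is $\psi\colon E\to E_0(\omega^\omega)$ such that for all $x$, $n$, $\psi(x)\not\leq^*\phi(x)(n)$. - $\mathsf{s}$: for every $\phi\colon E\to E_{\mathsf{set}}([\omega]^\omega)$ there is $\psi\colon E\to E_0([\omega]^\omega)$ such that for all $x$, $n$, $\psi(x)\subset^*\phi(x)(n)$ or $\psi(x)\subset^*\phi(x)(n)^c$. - $\mathsf{r}$: for every $\phi\colon E\to E_{\mathsf{set}}([\omega]^\omega)$ there is $\psi\colon E\to E_0([\omega]^\omega)$ such that for all $x$, $n$, $|\psi(x)\cap\phi(x)(n)|=|\psi(x)^c\cap\phi(x)(n)|=\aleph_0$. - $\mathsf{p}$: for every $\phi\colon E\to E_{\mathsf{set}}([\omega]^\omega)$ such that $\{\phi(x)(n):n\in\omega\}$ is centered for each $x$,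 there is $\psi\colon E\to E_0([\omega]^\omega)$ such that for all $x$, $n$, $\psi(x)\subset^*\phi(x)(n)$. - $\mathsf{t}$: for every $\phi\colon E\to E_{\mathsf{set}}([\omega]^\omega)$ such that for each $x$ the family $\{\phi(x)(n):n\in\omega\}$ admits a well-ordering compatible with $\subset^*$, there is $\psi\colon E\to E_0([\omega]^\omega)$ such that for all $x$, $n$, $\psi(x)\subset^*\phi(x)(n)$. - $\mathsf{a}$: for every $\phi\colon E\to E_{\mathsf{set}}([\omega]^\omega)$ such that $\{\phi(x)(n):n\in\omega\}$ is an infinite almost disjoint family for all $x$, there is $\psi\colon E\to E_0([\omega]^\omega)$ such that for all $x$, $n$, $|\psi(x)\cap\phi(x)(n)|<\aleph_0$. - $\mathsf{i}$: for every $\phi\colon E\to E_{\mathsf{set}}([\omega]^\omega)$ such that $\{\phi(x)(n):n\in\omega\}$ is independent for all $x$, there is $\psi\colon E\to E_0([\omega]^\omega)$ such that for all $x$, $\{\psi(x)\}\cup\{\phi(x)(n):n\in\omega\}$ is independent and $\psi(x)\neq^*\phi(x)(n)$ for all $n$. - $\mathsf{u}$: for every $\phi\colon E\to E_{\mathsf{set}}([\omega]^\omega)$ such that $\{\phi(x)(n):n\in\omega\}$ is centered for all $x$, there is $\psi\colon E\to E_0([\omega]^\omega)$ such that for all $x$, $n$, $|\psi(x)\cap\phi(x)(n)|=|\psi(x)^c\cap\phi(x)(n)|=\aleph_0$. *)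

(* Defs.v *)
From mathcomp Require Import all_boot all_order all_algebra.
From mathcomp Require Import all_classical all_reals all_analysis.

Set Implicit Arguments.
Unset Strict Implicit.
Unset Printing Implicit Defensive.

Local Open Scope classical_set_scope.

(* Borel structures are bare set systems rather than [measurableType]s: the
   latter are pointed, which would exclude the empty standard Borel space. *)

Definition polish (R : realType) (P : metricType R) : Prop :=
  (exists2 D : set P, countable D & dense D) /\
  (forall F : set_system P, ProperFilter F -> cauchy F -> exists p : P, F --> p).

Definition standard_borel (X : Type) (SX : set (set X)) : Prop :=
  exists (R : realType) (P : metricType R) (f : X -> P),
    [/\ polish P, bijective f
      & SX = preimage_set_system setT f <<s [set U : set P | open U] >>].

Definition borel_map (X Y : Type) (SX : set (set X)) (SY : set (set Y))
  (f : X -> Y) : Prop := forall B, SY B -> SX (f @^-1` B).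

Definition prod_borel (X Y : Type) (SX : set (set X)) (SY : set (set Y)) :
    set (set (X * Y)) :=
  <<s preimage_set_system setT fst SX `|` preimage_set_system setT snd SY >>.

(* The product Borel structure on [Z^omega]. *)
Definition seq_borel (Z : Type) (SZ : set (set Z)) : set (set (nat -> Z)) :=
  <<s \bigcup_n preimage_set_system setT (fun z : nat -> Z => z n) SZ >>.

Definition baire_borel : set (set (nat -> nat)) := seq_borel [set: set nat].

(* [2^omega] is [set nat], i.e. [nat -> Prop]: classically [Prop] has exactly two
   elements, and here it carries the discrete Borel structure. *)
Definition cantor_borel : set (set (set nat)) := seq_borel [set: set Prop].

Record infset := Infset { iset :> set nat ; isetP : infinite_set iset }.

Definition infset_borel : set (set infset) :=
  preimage_set_system setT iset cantor_borel.

Definition le_star (a b : nat -> nat) : Prop :=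
  \forall n \near \oo, (a n <= b n)%N.

Definition sub_star (A B : set nat) : Prop := finite_set (A `\` B).

Definition E0_baire (a b : nat -> nat) : Prop := \forall n \near \oo, a n = b n.

Definition E0_infset (A B : infset) : Prop :=
  finite_set ((A `\` B) `|` (B `\` A)).

Definition Eset (Z : Type) (z z' : nat -> Z) : Prop := range z = range z'.

Record countable_borel_equivalence (X : Type) (SX : set (set X))
    (E : X -> X -> Prop) : Prop := {
  cber_refl : forall x, E x x ;
  cber_sym : forall x y, E x y -> E y x ;
  cber_trans : forall x y z, E x y -> E y z -> E x z ;
  cber_borel : prod_borel SX SX [set p | E p.1 p.2] ;
  cber_countable : forall x, countable [set y | E x y]
}.

Definition borel_hom (X Y : Type) (SX : set (set X)) (E : X -> X -> Prop)
    (SY : set (set Y)) (F : Y -> Y -> Prop) (f : X -> Y) : Prop :=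
  borel_map SX SY f /\ forall x x', E x x' -> F (f x) (f x').

Definition centered (F : set infset) : Prop :=
  forall G : set infset, finite_set G -> G `<=` F ->
    infinite_set (\bigcap_(A in G) iset A).

Definition almost_disjoint (F : set infset) : Prop :=
  forall A B, F A -> F B -> A <> B -> finite_set (A `&` B).

Definition independent (F : set infset) : Prop :=
  forall G H : set infset, finite_set G -> finite_set H ->
    G `<=` F -> H `<=` F -> G `&` H = set0 ->
    infinite_set ((\bigcap_(A in G) iset A) `&` (\bigcap_(A in H) ~` iset A)).

Record well_ordering_of (T : Type) (F : set T) (W : T -> T -> Prop) : Prop := {
  wo_refl : forall A, F A -> W A A ;
  wo_antisym : forall A B, F A -> F B -> W A B -> W B A -> A = B ;
  wo_trans : forall A B C, F A -> F B -> F C -> W A B -> W B C -> W A C ;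
  wo_total : forall A B, F A -> F B -> W A B \/ W B A ;
  wo_least : forall G : set T, G `<=` F -> G !=set0 ->
    exists2 A, G A & forall B, G B -> W A B
}.

(* The well-ordering may run along almost inclusion in either direction; towers
   in the usual sense are the decreasing case. *)
Definition star_well_ordered (F : set infset) : Prop :=
  exists2 W : infset -> infset -> Prop, well_ordering_of F W &
    (forall A B, F A -> F B -> W A B -> sub_star B A) \/
    (forall A B, F A -> F B -> W A B -> sub_star A B).

Section properties.
Variables (X : Type) (SX : set (set X)) (E : X -> X -> Prop).

Definition hom_to_seq_baire (phi : X -> nat -> nat -> nat) : Prop :=
  borel_hom SX E (seq_borel baire_borel) (@Eset (nat -> nat)) phi.

Definition hom_to_baire (psi : X -> nat -> nat) : Prop :=
  borel_hom SX E baire_borel E0_baire psi.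

Definition hom_to_seq_infset (phi : X -> nat -> infset) : Prop :=
  borel_hom SX E (seq_borel infset_borel) (@Eset infset) phi.

Definition hom_to_infset (psi : X -> infset) : Prop :=
  borel_hom SX E infset_borel E0_infset psi.

Definition prop_b : Prop :=
  forall phi, hom_to_seq_baire phi ->
  exists2 psi, hom_to_baire psi & forall x n, le_star (phi x n) (psi x).

Definition prop_d : Prop :=
  forall phi, hom_to_seq_baire phi ->
  exists2 psi, hom_to_baire psi & forall x n, ~ le_star (psi x) (phi x n).

Definition prop_s : Prop :=
  forall phi, hom_to_seq_infset phi ->
  exists2 psi, hom_to_infset psi &
    forall x n, sub_star (psi x) (phi x n) \/ sub_star (psi x) (~` phi x n).

Definition prop_r : Prop :=
  forall phi, hom_to_seq_infset phi ->
  exists2 psi, hom_to_infset psi &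
    forall x n, infinite_set (psi x `&` phi x n) /\
                infinite_set (~` psi x `&` phi x n).

Definition prop_p : Prop :=
  forall phi, hom_to_seq_infset phi -> (forall x, centered (range (phi x))) ->
  exists2 psi, hom_to_infset psi & forall x n, sub_star (psi x) (phi x n).

Definition prop_t : Prop :=
  forall phi, hom_to_seq_infset phi ->
  (forall x, star_well_ordered (range (phi x))) ->
  exists2 psi, hom_to_infset psi & forall x n, sub_star (psi x) (phi x n).

Definition prop_a : Prop :=
  forall phi, hom_to_seq_infset phi ->
  (forall x, infinite_set (range (phi x)) /\ almost_disjoint (range (phi x))) ->
  exists2 psi, hom_to_infset psi & forall x n, finite_set (psi x `&` phi x n).

Definition prop_i : Prop :=
  forall phi, hom_to_seq_infset phi -> (forall x, independent (range (phi x))) ->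
  exists2 psi, hom_to_infset psi &
    forall x, independent (psi x |` range (phi x)) /\
              forall n, ~ E0_infset (psi x) (phi x n).

Definition prop_u : Prop :=
  forall phi, hom_to_seq_infset phi -> (forall x, centered (range (phi x))) ->
  exists2 psi, hom_to_infset psi &
    forall x n, infinite_set (psi x `&` phi x n) /\
                infinite_set (~` psi x `&` phi x n).

End properties.

(* Main.v *)
Require Import Defs.
From mathcomp Require Import all_boot all_order all_algebra.
From mathcomp Require Import all_classical all_reals all_analysis.
From mathcomp Require Import lra.

Set Implicit Arguments.
Unset Strict Implicit.
Unset Printing Implicit Defensive.

Local Open Scope classical_set_scope.

(** Seven of the eight implications are countable combinatorics made invariant: each
    witness is computed from the given one by a rule that depends on it only up to
    finitely many values, so that [E]-related points receive eventually equal
    witnesses.  For p to t, a family that is well-ordered by almost inclusion is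
    centered.  For p to a, the complements of an infinite almost disjoint family are
    centered.  For p to b, a pseudointersection of the regions above the graphs of the
    functions [f], cut off on the left, is a set of pairs whose second coordinates
    dominate (lemma [p_imp_b]).  For b to d, add one.  For b to r, a function dominating
    all next-element functions gives an interval partition almost all of whose blocks
    meet each given set, and the union of the even blocks splits them; the point is to
    produce the partition from the tail of the function alone ([endpoint]).  For r to i,
    split all the Boolean combinations of the family; r to u restricts to a special case.

    The implication from s to p is of a different kind.  The pseudointersection number
    is at most the splitting number and can be smaller, so the implication is not the
    shadow of an inequality between cardinals, and its proof goes through a dichotomy.
    Fix a homomorphism [phi] with centered values.  Call a Borel map from points to sets
    of numbers that is constant on [E]-classes a section.

    - If countably many sections produce every set [phi x n], then each class has an
      enumeration of its family depending only on the class, and the usual diagonal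
      pseudointersection is [E]-invariant ([pseudointersection_of_sections]).

    - Otherwise ([sections_or_embedding]) there are a Borel map from Cantor space to the
      given space sending eventually equal sequences to [E]-related points, and a
      choice of a member of the family at each of these points which depends
      continuously on the sequence and is not constant on any cylinder.  After passing to
      a subtree this member determines the sequence ([reparametrisation]), hence each
      member of the family determines a set of numbers recording the parities of the
      initial segments of its sequence.  A homomorphism [psi] not split by these sets
      contradicts Baire category: flipping one bit of the sequence exchanges, up to
      finitely many elements, the parity set with its complement, but does not change
      [psi] up to finitely many elements, so the set of sequences for which [psi] is
      almost contained in the parity set has the Baire property and is exchanged with
      its complement by every flip ([no_flip_alternating],
      [splitting_no_embedding]).

    The dichotomy is proved as for the Kechris-Solecki-Todorcevic graph, in the manner
    of Miller.  Points and witnesses are coded by elements of Baire space; one builds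
    finite configurations of points whose codes converge, keeping only finite constraints that
    can be realised outside of any countable family of sections.  If such a constraint
    cannot be refined, then the points that realise it carry a label constant on each
    [E]-class.  This label is a section: the two Suslin sets that decide whether [k]
    belongs to it are separated by an [E]-invariant Borel set ([invariant_separation]).
    So the constraint was not realisable outside of every countable family. *)

(** * Sets of natural numbers *)

Lemma finite_natP (A : set nat) :
  finite_set A <-> exists N, forall k, A k -> k < N.
Proof.
split=> [fA|[N AN]]; last by apply: sub_finite_set (finite_II N) => k /AN.
apply: contrapT => /forallNP unb.
have {}unb N : exists2 k, A k & N <= k.
  apply: contrapT => h; apply: (unb N) => k Ak; rewrite ltnNge; apply/negP => Nk.
  by apply: h; exists k.
have [n [g /= gP]] : exists n (g : nat -> nat), forall k, A k -> exists2 i, i < n & g i = k.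
  move/finite_setP: fA => [n]; rewrite card_eq_sym => /pcard_eqP[f].
  by exists n, f => k Ak; have [i /= iN <-] := @surj _ _ _ _ f k Ak; exists i.
have [k Ak] := unb (\max_(i < n) g i).+1.
have [i ltin <-] := gP k Ak.
by rewrite ltnNge (bigmax_sup (Ordinal ltin)).
Qed.

Lemma infinite_natP (A : set nat) :
  infinite_set A <-> forall N, exists2 k, N <= k & A k.
Proof.
split=> [iA N|iA /finite_natP[N AN]].
  apply: contrapT => h; apply: iA; apply/finite_natP; exists N => k Ak.
  by rewrite ltnNge; apply/negP => Nk; apply: h; exists k.
by have [k Nk /AN] := iA N; rewrite ltnNge Nk.
Qed.

(** * Borel predicates *)

Section BorelPredicates.
Variables (X : Type) (SX : set (set X)).
Hypothesis sigma : sigma_algebra setT SX.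

Lemma borel_ext (P Q : X -> Prop) :
  (forall x, P x <-> Q x) -> SX [set x | P x] -> SX [set x | Q x].
Proof. by move=> PQ; congr SX; apply/seteqP; split=> x /= /PQ. Qed.

Lemma borel_not (P : X -> Prop) : SX [set x | P x] -> SX [set x | ~ P x].
Proof. by case: sigma => _ + _ => /[apply]; apply: borel_ext => x; split=> [[]|]. Qed.

Lemma borel_ex (P : nat -> X -> Prop) :
  (forall n, SX [set x | P n x]) -> SX [set x | exists n, P n x].
Proof.
case: sigma => _ _ /[apply]; apply: borel_ext => x.
by split=> [[n _]|[n]]; exists n.
Qed.

Lemma borel_all (P : nat -> X -> Prop) :
  (forall n, SX [set x | P n x]) -> SX [set x | forall n, P n x].
Proof.
move=> bP; apply: (borel_ext (P := fun x => ~ exists n, ~ P n x)).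
  by move=> x; rewrite -forallNP; split=> h n; [apply: contrapT; apply: h|].
by apply/borel_not/borel_ex => n; apply: borel_not.
Qed.

Lemma borel_const (P : Prop) : SX [set x | P].
Proof.
case: sigma => S0 SC _; have [p|np] := pselect P.
  by have := SC _ S0; apply: borel_ext => x; split=> // _; split.
by move: S0; apply: borel_ext.
Qed.

Lemma borel_or (P Q : X -> Prop) :
  SX [set x | P x] -> SX [set x | Q x] -> SX [set x | P x \/ Q x].
Proof.
move=> bP bQ; apply: (borel_ext (P := fun x => exists n, if n is 0 then P x else Q x)).
  by move=> x; split=> [[[|n]]|[]]; [left|right|exists 0|exists 1].
by apply: borel_ex => -[].
Qed.

Lemma borel_and (P Q : X -> Prop) :
  SX [set x | P x] -> SX [set x | Q x] -> SX [set x | P x /\ Q x].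
Proof.
move=> bP bQ; apply: (borel_ext (P := fun x => forall n, if n is 0 then P x else Q x)).
  by move=> x; split=> [h|[? ?] [|n]//]; split; [apply: (h 0)|apply: (h 1)].
by apply: borel_all => -[].
Qed.

Lemma borel_imp (P Q : X -> Prop) :
  SX [set x | P x] -> SX [set x | Q x] -> SX [set x | P x -> Q x].
Proof.
move=> bP bQ; apply: (borel_ext (P := fun x => ~ P x \/ Q x)).
  move=> x; split=> [[nP /nP|]//|PQ].
  by case: (pselect (P x)) => [/PQ|]; [right|left].
by apply: borel_or => //; apply: borel_not.
Qed.

Lemma borel_iff (P Q : X -> Prop) :
  SX [set x | P x] -> SX [set x | Q x] -> SX [set x | P x <-> Q x].
Proof. by move=> bP bQ; apply: borel_and; apply: borel_imp. Qed.

Lemma borel_exC (I : countType) (P : I -> X -> Prop) :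
  (forall i, SX [set x | P i x]) -> SX [set x | exists i, P i x].
Proof.
move=> bP; apply: (borel_ext
  (P := fun x => exists n, if unpickle n is Some i then P i x else False)).
  move=> x; split=> [[n]|[i Pi]]; first by case: unpickle => // i; exists i.
  by exists (pickle i); rewrite pickleK.
by apply: borel_ex => n; case: unpickle => [i|]; [apply: bP|apply: (borel_const False)].
Qed.

(** Quantifying over a countable set of parameters of an arbitrary type is needed for
    countable families of sections. *)
Lemma borel_all_countable (T : Type) (D : set T) (P : T -> X -> Prop) :
  countable D -> (forall t, D t -> SX [set x | P t x]) ->
  SX [set x | forall t, D t -> P t x].
Proof.
move=> /countable_injP[i injD] bP.
apply: (borel_ext (P := fun x => forall n, forall t, D t -> i t = n -> P t x)).
  by move=> x; split=> [h t Dt|h n t Dt _]; [apply: (h (i t))|apply: h].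
apply: borel_all => n.
have [[t [Dt it]]|no] := pselect (exists t, D t /\ i t = n).
  have := bP t Dt; apply: borel_ext => x; split=> [Pt t' Dt' it'|]; last exact.
  by suff -> : t' = t by []; apply: injD; rewrite ?inE // it it'.
have := borel_const True; apply: borel_ext => x; split=> // _ t Dt it.
by case: no; exists t.
Qed.

End BorelPredicates.

(** * Borel maps into sequence spaces *)

Lemma borel_map_generated (X Y : Type) (SX : set (set X)) (G : set (set Y))
    (f : X -> Y) : sigma_algebra setT SX ->
  (forall B, G B -> SX (f @^-1` B)) -> borel_map SX <<s G >> f.
Proof.
move=> sX fG; apply: (smallest_sub (X := [set B | SX (f @^-1` B)])) => //.
split=> [|A|A hA] /=.
- exact: (borel_const sX False).
- move=> hA; have := borel_not sX hA; apply: borel_ext => x.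
  by split=> [|[]].
- have := borel_ex sX hA; apply: borel_ext => x.
  by split=> [[n An]|[n _ An]]; exists n.
Qed.

Section SequenceSpaces.
Variables (X : Type) (SX : set (set X)).
Hypothesis sX : sigma_algebra setT SX.

Lemma borel_map_seqP (Z : Type) (SZ : set (set Z)) (f : X -> nat -> Z) :
  borel_map SX (seq_borel SZ) f <-> forall n, borel_map SX SZ (fun x => f x n).
Proof.
split=> [bf n B SB|bf].
  apply: (bf [set z | B (z n)]); apply: sub_sigma_algebra.
  by exists n => //; exists B => //; rewrite setTI.
apply: borel_map_generated => // _ [n _ [B SB <-]].
by rewrite setTI; apply: bf.
Qed.

Lemma borel_map_natP (f : X -> nat) :
  borel_map SX [set: set nat] f <-> forall m, SX [set x | f x = m].
Proof.
split=> [bf m|bf B _]; first exact: (bf [set m]).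
apply: (borel_ext (P := fun x => exists m, f x = m /\ B m)).
  by move=> x; split=> [[m [-> //]]|Bf]; exists (f x).
by apply: borel_ex => // m; apply: borel_and => //; apply: borel_const.
Qed.

Lemma borel_map_baireP (f : X -> nat -> nat) :
  borel_map SX baire_borel f <-> forall n m, SX [set x | f x n = m].
Proof.
rewrite borel_map_seqP; split=> bf n; last exact/borel_map_natP.
exact/borel_map_natP.
Qed.

(** The discrete structure on propositions is generated by truth alone, since up to
    equality there are only two propositions. *)
Lemma borel_map_infsetP (f : X -> infset) :
  borel_map SX infset_borel f <-> forall n, SX [set x | iset (f x) n].
Proof.
transitivity (borel_map SX cantor_borel (fun x => iset (f x))).
  split=> bf B SB; first by apply: (bf (iset @^-1` B)); exists B => //; rewrite setTI.
  by case: SB => C SC <-; rewrite setTI; apply: (bf C).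
rewrite borel_map_seqP; split=> bf n; first by apply: (bf n id).
move=> B _; apply: (borel_ext (P := fun x => (iset (f x) n /\ B True) \/
                                          (~ iset (f x) n /\ B False))).
  move=> x /=; have [fn|fn] := pselect (iset (f x) n).
    have -> : iset (f x) n = True by apply/propext.
    tauto.
  have -> : iset (f x) n = False by apply/propext.
  tauto.
have bn := bf n.
apply: borel_or => //; apply: borel_and => //; try exact: borel_const.
exact: borel_not.
Qed.

Lemma borel_map_seq_infsetP (f : X -> nat -> infset) :
  borel_map SX (seq_borel infset_borel) f <->
  forall n k, SX [set x | iset (f x n) k].
Proof.
rewrite borel_map_seqP; split=> bf n; last exact/borel_map_infsetP.
exact/borel_map_infsetP.
Qed.

Lemma borel_map_seq_baireP (f : X -> nat -> nat -> nat) :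
  borel_map SX (seq_borel baire_borel) f <->
  forall n k m, SX [set x | f x n k = m].
Proof.
rewrite borel_map_seqP; split=> bf n; last exact/borel_map_baireP.
exact/borel_map_baireP.
Qed.

End SequenceSpaces.

Lemma infset_eq (A B : infset) : iset A = iset B -> A = B.
Proof.
by case: A B => [A iA] [B iB] /= AB; subst B; congr Infset; apply: Prop_irrelevance.
Qed.

Lemma standard_borel_sigma (X : Type) (SX : set (set X)) :
  standard_borel SX -> sigma_algebra setT SX.
Proof.
move=> [R [P [f [_ _ ->]]]].
exact/sigma_algebra_preimage/smallest_sigma_algebra.
Qed.

(** * Eventual behaviour and least elements *)

Lemma eventuallyP (P : nat -> Prop) :
  (\forall n \near \oo, P n) <-> exists N, forall n, N <= n -> P n.
Proof. by split=> [[N _ hN]|[N hN]]; exists N. Qed.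

Lemma sub_starP (A B : set nat) :
  sub_star A B <-> exists N, forall k, N <= k -> A k -> B k.
Proof.
rewrite /sub_star finite_natP; split=> -[N hN]; exists N.
  move=> k Nk Ak; apply: contrapT => nBk.
  by have := hN k (conj Ak nBk); rewrite ltnNge Nk.
move=> k [Ak nBk]; rewrite ltnNge; apply/negP => Nk.
exact: nBk (hN k Nk Ak).
Qed.

Lemma E0_infsetP (A B : infset) :
  E0_infset A B <-> exists N, forall k, N <= k -> (iset A k <-> iset B k).
Proof.
rewrite /E0_infset finite_natP; split=> -[N hN]; exists N.
  move=> k Nk; split=> [Ak|Bk]; apply: contrapT => n.
    by have := hN k (or_introl (conj Ak n)); rewrite ltnNge Nk.
  by have := hN k (or_intror (conj Bk n)); rewrite ltnNge Nk.
by move=> k [] [Pk nQk]; rewrite ltnNge; apply/negP => Nk; apply: nQk; apply/hN.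
Qed.

(** Minima over sets of numbers without a decision procedure. *)
Definition least (P : nat -> Prop) : nat :=
  xget 0 [set n | P n /\ forall m, m < n -> ~ P m].

Lemma leastP (P : nat -> Prop) : (exists n, P n) ->
  P (least P) /\ forall m, m < least P -> ~ P m.
Proof.
move=> [n Pn]; suff : exists k, P k /\ forall m, m < k -> ~ P m.
  by move=> ex; rewrite /least; have [] := xgetPex 0 ex.
elim/ltn_ind: n Pn => n IH Pn.
have [[m [mn Pm]]|no] := pselect (exists m, m < n /\ P m); first exact: IH Pm.
by exists n; split=> // m mn Pm; apply: no; exists m.
Qed.

Lemma least_le (P : nat -> Prop) n : P n -> least P <= n.
Proof.
move=> Pn; have [|_ h] := @leastP P; first by exists n.
by rewrite leqNgt; apply/negP => /h.
Qed.

Lemma eq_least (P Q : nat -> Prop) : (forall n, P n <-> Q n) -> least P = least Q.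
Proof. by move=> PQ; congr least; apply/funext => n; apply/propext. Qed.

Lemma borel_least (X : Type) (SX : set (set X)) (P : X -> nat -> Prop) :
  sigma_algebra setT SX -> (forall n, SX [set x | P x n]) ->
  (forall x, exists n, P x n) -> forall n, SX [set x | least (P x) = n].
Proof.
move=> sX bP exP n.
apply: (borel_ext (P := fun x => P x n /\ forall m, m < n -> ~ P x m)).
  move=> x; have [Pl minl] := leastP (exP x); split=> [[Pn minn]|<-//].
  apply/eqP; rewrite eqn_leq least_le //= leqNgt; apply/negP => /minn; exact.
apply: borel_and => //; apply: borel_all => // m.
by apply: borel_imp => //; [exact: borel_const|exact: borel_not].
Qed.

Lemma injective_unbounded (f : nat -> nat) : injective f ->
  forall M N, exists2 n, M <= n & N <= f n.
Proof.
move=> inj_f M N; apply: contrapT => no.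
have: {subset map f (iota M N.+1) <= iota 0 N}.
  move=> m /mapP[n]; rewrite !mem_iota => /andP[Mn _] ->; rewrite /= add0n.
  by rewrite ltnNge; apply/negP => Nf; apply: no; exists n.
have /uniq_leq_size/[apply] : uniq (map f (iota M N.+1)).
  by rewrite map_inj_uniq ?iota_uniq.
by rewrite size_map !size_iota ltnn.
Qed.

(** * Families of infinite sets *)

(** Turns quantification over finite subfamilies of an enumerated family into
    quantification over finite lists of indices, which is countable and hence harmless
    for measurability. *)
Lemma finite_sub_range (T : Type) (u : nat -> T) (G : set T) :
  finite_set G -> G `<=` range u -> exists s : seq nat, G = [set u n | n in [set` s]].
Proof.
move=> finG Gu; have [g gK] : {g : T -> nat & forall t, G t -> u (g t) = t}.
  apply: (choice (P := fun t n => G t -> u n = t)) => t.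
  have [/Gu[n _ <-]|] := pselect (G t); first by exists n.
  by exists 0.
have /(finite_seqP (T := nat))[s gs] := finite_image g finG.
exists s; apply/seteqP; split=> [t Gt|t [n]].
  by exists (g t); [rewrite -gs; exists t|apply: gK].
by rewrite -gs => -[t' Gt' <-]; rewrite gK // => <-.
Qed.

Lemma centeredP (u : nat -> infset) : centered (range u) <->
  forall s : seq nat, infinite_set [set k | forall i, i \in s -> iset (u i) k].
Proof.
split=> [cu s|cu G finG Gu].
  rewrite (_ : [set k | _] = \bigcap_(A in [set u n | n in [set` s]]) iset A); last first.
    by rewrite bigcap_image; apply/seteqP; split=> k h i /=; apply: h.
  by apply: cu; [apply: finite_image|move=> _ [n _ <-]; exists n].
have [s ->] := finite_sub_range finG Gu; move: (cu s); apply: contra_not.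
by apply: sub_finite_set => k h; rewrite bigcap_image => i; apply: h.
Qed.

Definition cell (u : nat -> infset) (s t : seq nat) : set nat :=
  [set k | (forall i, i \in s -> iset (u i) k) /\
           (forall j, j \in t -> ~ iset (u j) k)].

Definition separated (u : nat -> infset) (s t : seq nat) : Prop :=
  forall i j, i \in s -> j \in t -> u i <> u j.

Lemma independent_cell (u : nat -> infset) (s t : seq nat) :
  independent (range u) -> separated u s t -> infinite_set (cell u s t).
Proof.
move=> iu st.
have := iu [set u n | n in [set` s]] [set u n | n in [set` t]].
have fs (r : seq nat) : finite_set [set u n | n in [set` r]] by apply: finite_image.
have sub (r : seq nat) : [set u n | n in [set` r]] `<=` range u.
  by move=> _ [n _ <-]; exists n.
move=> /(_ (fs s) (fs t) (sub s) (sub t)) h.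
suff -> : cell u s t = (\bigcap_(A in [set u n | n in [set` s]]) iset A) `&`
            (\bigcap_(A in [set u n | n in [set` t]]) ~` iset A).
  apply: h; apply/eqP/negPn/negP => /set0P[_ [[i /= si <-] [j /= tj]]].
  by move/esym; apply: st.
by rewrite !bigcap_image; apply/seteqP; split=> k [h1 h2]; split=> i; by [apply: h1|apply: h2].
Qed.

(** Totalises the inclusion of the infinite sets into all sets, so that families can
    be defined before their members are known to be infinite. *)
Definition to_infset (A : set nat) : infset :=
  if pselect (infinite_set A) is left iA then Infset iA else Infset infinite_nat.

Lemma to_infsetE (A : set nat) : infinite_set A -> iset (to_infset A) = A.
Proof. by rewrite /to_infset; case: pselect. Qed.

Lemma borel_to_infset (X : Type) (SX : set (set X)) (A : X -> set nat) :
  sigma_algebra setT SX -> (forall k, SX [set x | A x k]) ->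
  forall k, SX [set x | iset (to_infset (A x)) k].
Proof.
move=> sX bA k.
apply: (borel_ext (P := fun x => (forall N, exists n, N <= n /\ A x n) -> A x k)).
  move=> x; have iP : infinite_set (A x) <-> forall N, exists n, N <= n /\ A x n.
    by rewrite infinite_natP; split=> h N; have [n] := h N; [move=> ? ?|case]; exists n.
  rewrite -iP /to_infset; case: pselect => /= iA; first by split=> [/(_ iA)|].
  by split.
apply: borel_imp => //; apply: borel_all => // N; apply: borel_ex => // n.
by apply: borel_and => //; apply: borel_const.
Qed.

Lemma borel_infset_eq (X : Type) (SX : set (set X)) (f g : X -> infset) :
  sigma_algebra setT SX -> (forall k, SX [set x | iset (f x) k]) ->
  (forall k, SX [set x | iset (g x) k]) -> SX [set x | f x = g x].
Proof.
move=> sX bf bg; apply: (borel_ext (P := fun x => forall k, iset (f x) k <-> iset (g x) k)).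
  move=> x; split=> [fg|-> //]; apply: infset_eq.
  by apply/seteqP; split=> k /fg.
by apply: borel_all => // k; apply: borel_iff.
Qed.

Lemma Eset_comp (Y Z : Type) (F : Y -> Z) (u v : nat -> Y) :
  Eset u v -> Eset (F \o u) (F \o v).
Proof. by rewrite /Eset => uv; rewrite -!(image_comp u F) -!(image_comp v F) uv. Qed.

(** Transports families built from finitely many members of [u] to families built
    from members of [v], by reindexing. *)
Lemma Eset_index (Z : Type) (u v : nat -> Z) : Eset u v ->
  exists g : nat -> nat, forall i, u i = v (g i).
Proof.
move=> uv; suff /choice[g] : forall i, exists j, u i = v j by exists g.
move=> i; have : range u (u i) by exists i.
by rewrite uv => -[j _ <-]; exists j.
Qed.

(** * Interval partitions *)

(** Iterating [g] from [0] would give an interval partition that depends on every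
    value of [g]; starting the [n]-th iteration at [n] makes the [n]-th endpoint depend
    only on the values of [g] from [n] on, so that functions that are eventually equal
    give partitions that are eventually equal. *)
Definition endpoint (g : nat -> nat) (n : nat) : nat := iter n g n.

Section Endpoints.
Variable g : nat -> nat.
Hypotheses (g_mono : {homo g : m n / m <= n}) (g_gt : forall n, n < g n).

Lemma iter_mono k : {homo iter k g : m n / m <= n}.
Proof. by elim: k => // k IH m n /IH/g_mono. Qed.

Lemma endpointS n : g (endpoint g n) <= endpoint g n.+1.
Proof. by rewrite /endpoint -iterS; apply: iter_mono. Qed.

Lemma endpoint_ge n : n <= endpoint g n.
Proof.
rewrite /endpoint; move: {1 3}n => m; elim: n => //= n IH.
exact: leq_trans IH (ltnW (g_gt _)).
Qed.

Lemma endpoint_lt m n : m < n -> endpoint g m < endpoint g n.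
Proof.
elim: n => // n IH; rewrite ltnS leq_eqVlt => mn.
have lt : endpoint g n < endpoint g n.+1 by apply: leq_trans (g_gt _) (endpointS n).
by case/predU1P: mn => [->|/IH/ltn_trans]; last apply.
Qed.

Lemma endpoint_uniq k m n : endpoint g m <= k < endpoint g m.+1 ->
  endpoint g n <= k < endpoint g n.+1 -> m = n.
Proof.
have mono i j : i <= j -> endpoint g i <= endpoint g j.
  by rewrite leq_eqVlt => /predU1P[->//|/endpoint_lt/ltnW].
move=> /andP[mk km] /andP[nk kn]; case: (ltngtP m n) => // /mono h.
  by have := leq_trans km (leq_trans h nk); rewrite ltnn.
by have := leq_trans kn (leq_trans h mk); rewrite ltnn.
Qed.

End Endpoints.

(** The [n]-th orbit starts at [n] and increases, so it never meets a value below [N]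
    when [N <= n]. *)
Lemma eq_endpoint (g h : nat -> nat) N : (forall n, n < g n) ->
  (forall n, N <= n -> g n = h n) -> forall n, N <= n -> endpoint g n = endpoint h n.
Proof.
move=> g_gt gh n Nn; rewrite /endpoint.
suff : forall k m, N <= m -> iter k g m = iter k h m /\ N <= iter k g m by move=> /(_ n n Nn)[].
elim=> [|k IH] m Nm; first by split.
by rewrite !iterS; have [<- h1] := IH m Nm; rewrite gh //; split=> //;
   rewrite -gh //; apply: leq_trans h1 (ltnW (g_gt _)).
Qed.

(** * The elementary implications *)

Section Implications.
Variables (X : Type) (SX : set (set X)) (E : X -> X -> Prop).
Hypotheses (sX : sigma_algebra setT SX) (symE : forall x y, E x y -> E y x).

Lemma b_imp_d : prop_b SX E -> prop_d SX E.
Proof.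
move=> hb phi hphi; have [psi [bpsi Epsi] dom] := hb phi hphi.
exists (fun x n => (psi x n).+1); first split.
- apply/borel_map_baireP => // n [|m].
    by have := borel_const sX False; apply: borel_ext.
  move/borel_map_baireP: bpsi => /(_ sX n m); apply: borel_ext => x.
  by split=> [->|[]].
- move=> x x' /Epsi /eventuallyP[N hN]; apply/eventuallyP.
  by exists N => n /hN ->.
move=> x n /eventuallyP[N hN].
have /eventuallyP[M hM] := dom x n.
have := leq_trans (hN _ (leq_maxl N M)) (hM _ (leq_maxr N M)).
by rewrite ltnn.
Qed.

Lemma r_imp_u : prop_r SX E -> prop_u SX E.
Proof. by move=> hr phi hphi _; apply: hr. Qed.

(** Any finite subfamily has a member almost contained in
    all the others, whichever way the well-ordering runs. *)
Lemma star_well_ordered_centered (u : nat -> infset) :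
  star_well_ordered (range u) -> centered (range u).
Proof.
case=> W [_ _ _ total _] cmp.
have {total cmp}cmp i j : sub_star (u i) (u j) \/ sub_star (u j) (u i).
  have ri k : range u (u k) by exists k.
  by case: cmp => cmp; have [] := total _ _ (ri i) (ri j) => Wij;
    [right|left|left|right]; apply: cmp.
apply/centeredP => s.
have [m hm] : exists m, forall i, i \in s -> sub_star (u m) (u i).
  elim: s => [|i s [m hm]]; first by exists 0.
  have [im|mi] := cmp i m; [exists i|exists m] => j; rewrite inE => /orP[/eqP ->|js] //.
  - by apply/sub_starP; exists 0.
  - move/hm: js => /sub_starP[N hN]; move/sub_starP: im => [M hM]; apply/sub_starP.
    exists (maxn N M) => k; rewrite geq_max => /andP[Nk Mk] uk; apply: hN => //.
    exact: hM.
  - exact: hm.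
have [N hN] : exists N, forall k, N <= k -> iset (u m) k -> forall i, i \in s -> iset (u i) k.
  elim: s hm => [|i s IH] hm; first by exists 0.
  have [j js|N hN] := IH; first by apply: hm; rewrite inE js orbT.
  have /sub_starP[M hM] := hm i (mem_head _ _).
  exists (maxn N M) => k; rewrite geq_max => /andP[Nk Mk] uk j.
  by rewrite inE => /orP[/eqP ->|js]; [apply: hM|apply: hN].
apply/infinite_natP => M.
have /infinite_natP/(_ (maxn M N))[k + uk] := @isetP (u m).
by rewrite geq_max => /andP[Mk Nk]; exists k => // i; apply: hN.
Qed.

Lemma p_imp_t : prop_p SX E -> prop_t SX E.
Proof.
by move=> hp phi hphi wphi; apply: hp => // x; apply: star_well_ordered_centered.
Qed.

(** A member of the family outside of the list is almost contained in the complements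
    of all the members in the list. *)
Lemma almost_disjoint_complements (u : nat -> infset) (s : seq nat) :
  infinite_set (range u) -> almost_disjoint (range u) ->
  infinite_set [set k | forall i, i \in s -> ~ iset (u i) k].
Proof.
move=> infu ad.
have [j hj] : exists j, forall i, i \in s -> u i <> u j.
  apply: contrapT => no; apply: infu; apply: (sub_finite_set (B := [set u n | n in [set` s]])).
    move=> _ [j _ <-]; apply: contrapT => nj; apply: no; exists j => i si ij.
    by apply: nj; exists i.
  exact: finite_image.
have [N hN] : exists N, forall k, N <= k -> iset (u j) k -> forall i, i \in s -> ~ iset (u i) k.
  elim: s hj => [|i s IH] hj; first by exists 0.
  have [l ls|N hN] := IH; first by apply: hj; rewrite inE ls orbT.
  have : finite_set (u i `&` u j) by apply: ad; [exists i|exists j|apply: hj; exact: mem_head].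
  move=> /finite_natP[M hM]; exists (maxn N M) => k; rewrite geq_max => /andP[Nk Mk] uk l.
  rewrite inE => /orP[/eqP -> ui|ls]; last exact: hN.
  by have := hM k (conj ui uk); rewrite ltnNge Mk.
apply/infinite_natP => M.
have /infinite_natP/(_ (maxn M N))[k + uk] := @isetP (u j).
by rewrite geq_max => /andP[Mk Nk]; exists k => // i; apply: hN.
Qed.

Lemma p_imp_a : prop_p SX E -> prop_a SX E.
Proof.
move=> hp phi [bphi Ephi] aphi.
have co x n : iset (to_infset (~` phi x n)) = ~` phi x n.
  apply: to_infsetE; have [i a] := aphi x.
  have := @almost_disjoint_complements _ [:: n] i a; apply: contra_not.
  by apply: sub_finite_set => k h nk; apply: (h n) nk; rewrite inE.
have [||psi hpsi sub] := hp (fun x n => to_infset (~` phi x n)).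
- split; last by move=> x x' /Ephi; apply: (Eset_comp (fun A => to_infset (~` iset A))).
  apply/borel_map_seq_infsetP => // n; apply: borel_to_infset => // k.
  by apply: borel_not => //; apply/borel_map_seq_infsetP : n k.
- move=> x; apply/centeredP => s; have [i a] := aphi x.
  have := @almost_disjoint_complements (phi x) s i a; apply: contra_not.
  by apply: sub_finite_set => k h i' /h; rewrite co.
exists psi => // x n; have := sub x n; rewrite co.
by rewrite /sub_star; apply: sub_finite_set => k [? ?]; split.
Qed.

(** A set that splits every infinite Boolean combination of the family is independent
    from it.  The combinations are enumerated by pairs of lists of indices; the pairs
    that would use one member both ways are replaced by the set of all numbers. *)
Lemma r_imp_i : prop_r SX E -> prop_i SX E.
Proof.
move=> hr phi [bphi Ephi] iphi.
pose C x (q : seq nat * seq nat) := [set k | separated (phi x) q.1 q.2 /\ cell (phi x) q.1 q.2 k].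
pose chi x n := to_infset (C x (odflt ([::], [::]) (unpickle n))).
have bmem : forall n k, SX [set x | iset (phi x n) k] by apply/borel_map_seq_infsetP.
have bchi : borel_map SX (seq_borel infset_borel) chi.
  apply/borel_map_seq_infsetP => // n; apply: borel_to_infset => // k.
  move: (odflt _ _) => [s t] /=; apply: borel_and => //; last apply: borel_and => //.
  - apply: borel_all => // i; apply: borel_all => // j.
    apply: borel_imp => //; first exact: borel_const.
    apply: borel_imp => //; first exact: borel_const.
    by apply: borel_not => //; apply: borel_infset_eq.
  - by apply: borel_all => // i; apply: borel_imp => //; exact: borel_const.
  - apply: borel_all => // i; apply: borel_imp => //; first exact: borel_const.
    exact: borel_not.
have Echi_sub x x' : E x x' -> range (chi x) `<=` range (chi x').
  move=> /Ephi/Eset_index[g gP] _ [n _ <-]; rewrite /chi.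
  move: (odflt _ _) => [s t]; exists (pickle (map g s, map g t)) => //.
  rewrite pickleK /=; congr to_infset; rewrite /C /separated /cell /=.
  apply/seteqP; split=> k [sep [hs ht]]; split.
  - by move=> i j si tj; rewrite !gP; apply: sep; apply: map_f.
  - by split=> i si; rewrite gP; [apply: hs|apply: ht]; apply: map_f.
  - by move=> _ _ /mapP[i si ->] /mapP[j tj ->]; rewrite -!gP; apply: sep.
  - by split=> _ /mapP[i si ->]; rewrite -gP; [apply: hs|apply: ht].
have [|psi hpsi split_psi] := hr chi.
  split=> // x x' Exx'; apply/seteqP; split; apply: Echi_sub => //.
  exact: symE.
have split_cell x s t : separated (phi x) s t ->
    infinite_set (psi x `&` cell (phi x) s t) /\
    infinite_set (~` psi x `&` cell (phi x) s t).
  move=> st; have := split_psi x (pickle (s, t)); rewrite /chi pickleK /=.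
  suff Cst : C x (s, t) = cell (phi x) s t.
    by rewrite to_infsetE Cst //; apply: independent_cell.
  by apply/seteqP; split=> k // [].
exists psi => // x; split=> [G H finG finH Gsub Hsub GH|n]; last first.
  (* The combination consisting of one member alone shows that the two sets differ. *)
  have [|_] := split_cell x [:: n] [::]; first by move=> i j _.
  rewrite /E0_infset => inf fin; apply: inf; apply: sub_finite_set fin.
  by move=> k [npsi [h _]]; right; split=> //; apply: h; rewrite inE.
have small (F : set infset) : finite_set F -> F `<=` psi x |` range (phi x) ->
    exists s : seq nat, F `\ psi x = [set phi x n | n in [set` s]].
  move=> finF Fsub; apply: finite_sub_range; first exact: finite_setD.
  by move=> A [/Fsub[->|//] /(_ erefl)].
have [s Gs] := small G finG Gsub; have [t Ht] := small H finH Hsub.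
have [|inf1 inf2] := split_cell x s t.
  move=> i j si tj ij.
  have : (G `\ psi x) (phi x i) by rewrite Gs; exists i.
  have : (H `\ psi x) (phi x i) by rewrite Ht ij; exists j.
  move=> [Hi _] [Gi _]; have : (G `&` H) (phi x i) by split.
  by rewrite GH.
have inG k A : cell (phi x) s t k -> G A -> A <> psi x -> iset A k.
  move=> [h _] GA Apsi; have : (G `\ psi x) A by split.
  by rewrite Gs => -[n sn <-]; apply: h.
have inH k A : cell (phi x) s t k -> H A -> A <> psi x -> ~ iset A k.
  move=> [_ h] HA Apsi; have : (H `\ psi x) A by split.
  by rewrite Ht => -[n tn <-]; apply: h.
have [Gpsi|nGpsi] := pselect (G (psi x)).
  move: inf1; apply: contra_not; apply: sub_finite_set => k [psik ck]; split=> A FA.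
    by have [->|] := pselect (A = psi x); last exact: inG.
  apply: inH => // Apsi; have : (G `&` H) A by split=> //; rewrite Apsi.
  by rewrite GH.
move: inf2; apply: contra_not; apply: sub_finite_set => k [psik ck]; split=> A FA.
  by apply: inG => // Apsi; apply: nGpsi; rewrite -Apsi.
by have [->|] := pselect (A = psi x); last exact: inH.
Qed.


(** Numbers code pairs.  [above f k] consists of the pairs whose first coordinate is at
    least [k] and whose second coordinate bounds [f] up to the first one.  In a
    pseudointersection of all these sets, the value at [j] is the second coordinate of the
    first pair that has both code and first coordinate at least [j]. *)
Lemma p_imp_b : prop_p SX E -> prop_b SX E.
Proof.
move=> hp phi [/(borel_map_seq_baireP sX) bphi Ephi].
pose dec c : nat * nat := odflt (0, 0) (unpickle c).
have decK q : dec (pickle q) = q by rewrite /dec pickleK.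
pose above (f : nat -> nat) k :=
  [set c | k <= (dec c).1 /\ forall i, i <= (dec c).1 -> f i <= (dec c).2].
pose chi x n := to_infset (above (phi x (dec n).1) (dec n).2).
have inf_above (u : nat -> nat -> nat) (s : seq nat) :
    infinite_set [set c | forall n, n \in s -> above (u (dec n).1) (dec n).2 c].
  apply/infinite_natP => N.
  pose K := \max_(n <- s) (dec n).2.
  pose M := \max_(n <- s) \max_(i < K.+1) u (dec n).1 i.
  have inj : injective (fun m : nat => pickle (K, m)).
    by move=> m m' e; have [] := pcan_inj (@pickleK _) e.
  have [m Mm Nm] := injective_unbounded inj M N.
  exists (pickle (K, m)) => // n sn; rewrite /above /= decK /=.
  split=> [|i]; first exact: (leq_bigmax_seq (F := fun n => (dec n).2)).
  rewrite -ltnS => iK; apply: leq_trans Mm.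
  have Fn : \max_(i < K.+1) u (dec n).1 i <= M.
    exact: (leq_bigmax_seq (F := fun n => \max_(i < K.+1) u (dec n).1 i)).
  apply: leq_trans Fn.
  exact: (leq_bigmax (F := fun i : 'I_K.+1 => u (dec n).1 i) (Ordinal iK)).
have chiE x n : iset (chi x n) = above (phi x (dec n).1) (dec n).2.
  apply: to_infsetE; have := inf_above (phi x) [:: n]; apply: contra_not.
  by apply: sub_finite_set => c h; apply: h; rewrite inE.
have [||psi [/(borel_map_infsetP sX) bpsi Epsi] sub] := hp chi.
- split.
    apply/borel_map_seq_infsetP => // n; apply: borel_to_infset => // c.
    apply: borel_and => //; first exact: borel_const.
    apply: borel_all => // i; apply: borel_imp => //; first exact: borel_const.
    apply: (borel_ext (P := fun x => exists m, phi x (dec n).1 i = m /\ m <= (dec c).2)).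
      by move=> x; split=> [[m [-> //]]|?]; exists (phi x (dec n).1 i).
    by apply: borel_ex => // m; apply: borel_and => //; exact: borel_const.
  have Esub x x' : E x x' -> range (chi x) `<=` range (chi x').
    move=> /Ephi/Eset_index[g gP] _ [n _ <-].
    exists (pickle (g (dec n).1, (dec n).2)) => //.
    by rewrite /chi !decK /= -gP.
  by move=> x x' Exx'; apply/seteqP; split; apply: Esub => //; apply: symE.
- move=> x; apply/centeredP => s; have := inf_above (phi x) s; apply: contra_not.
  by apply: sub_finite_set => c h n /h; rewrite chiE.
(* Requiring the code to be at least [j] makes the value at [j] depend only on the part
   of the pseudointersection above [j]. *)
pose Q x j c := [/\ iset (psi x) c, j <= c & j <= (dec c).1].
have exQ x j : exists c, Q x j c.
  have /sub_starP[N hN] := sub x (pickle (0, j)).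
  have /infinite_natP/(_ (maxn N j))[c] := @isetP (psi x).
  rewrite geq_max => /andP[Nc jc] psic; exists c; split=> //.
  by have := hN _ Nc psic; rewrite chiE decK /= => -[].
have bQ j c : SX [set x | Q x j c].
  apply: (borel_ext (P := fun x => iset (psi x) c /\ (j <= c /\ j <= (dec c).1))).
    by move=> x; split=> [[? []]|[]].
  by apply: borel_and => //; apply: borel_const.
exists (fun x j => (dec (least (Q x j))).2); first split.
- apply/borel_map_baireP => // j m.
  apply: (borel_ext (P := fun x => exists c, least (Q x j) = c /\ (dec c).2 = m)).
    by move=> x; split=> [[c [-> //]]|?]; exists (least (Q x j)).
  apply: borel_ex => // c; apply: borel_and => //; last exact: borel_const.
  exact: borel_least.
- move=> x x' /Epsi/E0_infsetP[N hN]; apply/eventuallyP; exists N => j Nj.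
  congr (dec _).2; apply: eq_least => c.
  by split=> -[psic jc jd]; split=> //; apply/hN => //; apply: leq_trans jc.
move=> x n; apply/eventuallyP.
have /sub_starP[N hN] := sub x (pickle (n, 0)).
exists N => j Nj; have [[psic jc jd] _] := leastP (exQ x j).
have := hN _ (leq_trans Nj jc) psic.
by rewrite chiE decK /= => -[_]; apply.
Qed.

(** If [psi] dominates the next-element functions of the sets, so does its tail minimum
    [g], which is moreover monotone and depends at [n] only on the values of [psi] from
    [n] on.  Then almost every block between consecutive endpoints of [g] meets every
    set. *)
Lemma b_imp_r : prop_b SX E -> prop_r SX E.
Proof.
move=> hb phi [/(borel_map_seq_infsetP sX) bphi Ephi].
pose next (A : infset) k := least (fun m => k <= m /\ iset A m).
have ex_next (A : infset) k : exists m, k <= m /\ iset A m.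
  by have /infinite_natP/(_ k)[m] := @isetP A; exists m.
have nextP (A : infset) k : k <= next A k /\ iset A (next A k).
  exact: (leastP (ex_next A k)).1.
have [|psi [/(borel_map_baireP sX) bpsi Epsi] dom] := hb (fun x n => next (phi x n)).
  split; last by move=> x x' /Ephi; apply: (Eset_comp next).
  apply/borel_map_seq_baireP => // n k m; apply: borel_least => // m'.
  by apply: borel_and => //; apply: borel_const.
(* Adding [m.+1] makes [g] strictly exceed the identity. *)
pose Q x n v := exists m, n <= m /\ psi x m + m.+1 = v.
have exQ x n : exists v, Q x n v by exists (psi x n + n.+1), n.
have bQ n v : SX [set x | Q x n v].
  apply: borel_ex => // m; apply: borel_and => //; first exact: borel_const.
  apply: (borel_ext (P := fun x => exists u, psi x m = u /\ u + m.+1 = v)).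
    by move=> x; split=> [[u [-> //]]|?]; exists (psi x m).
  by apply: borel_ex => // u; apply: borel_and => //; exact: borel_const.
pose g x n := least (Q x n).
have gP x n : Q x n (g x n) := (leastP (exQ x n)).1.
have g_gt x n : n < g x n.
  by have [m [nm <-]] := gP x n; rewrite addnS ltnS; apply: leq_trans nm (leq_addl _ _).
have g_mono x : {homo g x : m n / m <= n}.
  move=> m n mn; apply: least_le; have [k [nk gk]] := gP x n.
  by exists k; split=> //; apply: leq_trans nk.
have bg n v : SX [set x | g x n = v] by apply: borel_least.
have biter k n v : SX [set x | iter k (g x) n = v].
  elim: k v => [|k IH] v /=; first exact: borel_const.
  apply: (borel_ext (P := fun x => exists u, iter k (g x) n = u /\ g x u = v)).
    by move=> x; split=> [[u [-> //]]|?]; exists (iter k (g x) n).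
  by apply: borel_ex => // u; apply: borel_and.
pose b x n := endpoint (g x) n.
pose S x := [set k | exists n, ~~ odd n /\ b x n <= k < b x n.+1].
have hit x n : exists N, forall m, N <= m ->
    b x m <= next (phi x n) (b x m) < b x m.+1 /\ iset (phi x n) (next (phi x n) (b x m)).
  have /eventuallyP[N hN] := dom x n; exists N => m Nm.
  have [ge inA] := nextP (phi x n) (b x m); split=> //; rewrite ge /=.
  apply: leq_trans (endpointS (g_mono x) m).
  have [k [bk <-]] := gP x (b x m).
  rewrite addnS ltnS; apply: leq_trans (leq_addr _ _); apply: leq_trans (hN k _).
    apply: least_le; have [kn An] := nextP (phi x n) k; split=> //.
    exact: leq_trans kn.
  exact: leq_trans (leq_trans Nm (endpoint_ge (g_gt x) m)) bk.
have far x n (e : bool) N : exists k m, [/\ N <= k, odd m = e, b x m <= k < b x m.+1 & iset (phi x n) k].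
  have [M hM] := hit x n; pose m := e + (maxn M N).*2.
  have MNm : maxn M N <= m by rewrite /m -addnn addnCA leq_addr.
  have [inb inA] := hM m (leq_trans (leq_maxl M N) MNm).
  exists (next (phi x n) (b x m)), m; split=> //.
    apply: leq_trans (proj1 (nextP _ _)); apply: leq_trans (endpoint_ge (g_gt x) m).
    exact: leq_trans (leq_maxr M N) MNm.
  by rewrite /m oddD odd_double addbF oddb.
have inS x n : infinite_set (S x `&` phi x n).
  apply/infinite_natP => N; have [k [m [Nk om bk Ak]]] := far x n false N.
  by exists k => //; split=> //; exists m; rewrite om.
have outS x n : infinite_set (~` S x `&` phi x n).
  apply/infinite_natP => N; have [k [m [Nk om bk Ak]]] := far x n true N.
  exists k => //; split=> // -[m' [om' bk']].
  by move: om'; rewrite -(endpoint_uniq (g_mono x) (g_gt x) bk bk') om.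
have SE x : iset (to_infset (S x)) = S x.
  apply: to_infsetE; apply: contra_not (inS x 0); apply: sub_finite_set.
  exact: subIsetl.
exists (fun x => to_infset (S x)); last by move=> x n; rewrite SE.
split.
  apply/borel_map_infsetP => // k; apply: borel_to_infset => // {}k.
  apply: borel_ex => // n; apply: borel_and => //; first exact: borel_const.
  apply: (borel_ext (P := fun x => exists u v, (b x n = u /\ b x n.+1 = v) /\ u <= k < v)).
    move=> x; split=> [[u [v [[-> ->]]]]//|bk].
    by exists (b x n), (b x n.+1).
  apply: borel_ex => // u; apply: borel_ex => // v.
  by apply: borel_and => //; [apply: borel_and => //; apply: biter|apply: borel_const].
move=> x x' /Epsi/eventuallyP[N hN]; apply/E0_infsetP.
have gg n : N <= n -> g x n = g x' n.
  move=> Nn; apply: eq_least => v; split=> -[m [nm <-]]; exists m; split=> //;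
    by rewrite hN //; apply: leq_trans nm.
have bb n : N <= n -> b x n = b x' n by apply: eq_endpoint.
have mono y i j : i <= j -> b y i <= b y j.
  by rewrite leq_eqVlt => /predU1P[->//|/(endpoint_lt (g_mono y) (g_gt y))/ltnW].
have big y k n : b y N <= k -> k < b y n.+1 -> N <= n.
  move=> bk kb; rewrite -ltnS ltnNge; apply/negP => /(mono y) h.
  by have := leq_trans kb (leq_trans h bk); rewrite ltnn.
exists (b x N) => k bk; rewrite !SE; split=> -[n [on bnk]]; exists n; split=> //.
  case/andP: (bnk) => _ /(big x _ _ bk) Nn.
  by rewrite -!bb // (leq_trans Nn).
case/andP: (bnk) => _; rewrite bb // in bk => /(big x' _ _ bk) Nn.
by rewrite !bb // (leq_trans Nn).
Qed.

End Implications.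

(** * Suslin sets of Baire space *)

Definition agree (T : Type) (n : nat) (a b : nat -> T) : Prop :=
  forall i, i < n -> a i = b i.

Lemma agree_sym (T : Type) n (a b : nat -> T) : agree n a b -> agree n b a.
Proof. by move=> ab i /ab. Qed.

Lemma agree_trans (T : Type) n (a b c : nat -> T) :
  agree n a b -> agree n b c -> agree n a c.
Proof. by move=> ab bc i ltin; rewrite ab ?bc. Qed.

Lemma agree_le (T : Type) m n (a b : nat -> T) : m <= n -> agree n a b -> agree m a b.
Proof. by move=> mn ab i im; apply: ab; apply: leq_trans mn. Qed.

(** If [I n a] depends only on the first [n] values of [a], then one-step extensions can
    be continued to a single sequence. *)
Lemma fusion (T : Type) (I : nat -> (nat -> T) -> Prop) (a0 : nat -> T) :
  (forall n a b, agree n a b -> I n a -> I n b) -> I 0 a0 ->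
  (forall n a, I n a -> exists b, agree n a b /\ I n.+1 b) ->
  exists a, forall n, I n a.
Proof.
move=> Iagree I0 Istep.
pose S := {q : nat * (nat -> T) | I q.1 q.2}.
pose R (p q : S) := (sval q).1 = (sval p).1.+1 /\ agree (sval p).1 (sval p).2 (sval q).2.
have step (p : S) : {q : S | R p q}.
  apply: cid; case: p => -[n a] /= Ia; have [b [ab Ib]] := Istep n a Ia.
  by exists (exist _ (n.+1, b) Ib).
have [s [s0 Rs]] := dependent_choice step (exist _ (0, a0) I0).
have lvl n : (sval (s n)).1 = n.
  by elim: n => [|n IH]; [rewrite s0|rewrite (Rs n).1 IH].
pose c n := (sval (s n)).2.
have cS n : agree n (c n) (c n.+1) by have := (Rs n).2; rewrite lvl.
have cagree m n : m <= n -> agree m (c m) (c n).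
  elim: n => [|n IH]; first by rewrite leqn0 => /eqP ->.
  rewrite leq_eqVlt => /predU1P[->//|]; rewrite ltnS => mn.
  by apply: agree_trans (IH mn) _; apply: agree_le (cS n).
exists (fun i => c i.+1 i) => n; apply: (Iagree n (c n)); last first.
  by have := svalP (s n); rewrite lvl.
by move=> i ltin; symmetry; apply: cagree.
Qed.

Definition continuousN (g : (nat -> nat) -> (nat -> nat)) : Prop :=
  forall w i, exists m, forall v, agree m w v -> g w i = g v i.

Lemma continuousN_agree g : continuousN g ->
  forall w n, exists m, forall v, agree m w v -> agree n (g w) (g v).
Proof.
move=> cg w; elim=> [|n [m hm]]; first by exists 0.
have [k hk] := cg w n; exists (maxn m k) => v wv i.
rewrite ltnS leq_eqVlt => /predU1P[->|ltin].
  by apply: hk; apply: agree_le wv; exact: leq_maxr.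
by apply: hm => //; apply: agree_le wv; exact: leq_maxl.
Qed.

(** Baire space is identified with the product of countably many copies of itself:
    [component j] is the [j]-th projection and [join] assembles a point.  Since the
    pairing of numbers need not be onto, [join] is only a right inverse of the
    projections. *)
Definition component (j : nat) (w : nat -> nat) : nat -> nat := fun i => w (pickle (j, i)).

Definition join (u : nat -> nat -> nat) : nat -> nat :=
  fun n => if unpickle n is Some (j, i) then u j i else 0.

Definition pairN (a b : nat -> nat) : nat -> nat :=
  join (fun j => if j is 0 then a else b).

Lemma component_join u j : component j (join u) = u j.
Proof. by apply/funext => i; rewrite /component /join pickleK. Qed.

Lemma component_pair0 a b : component 0 (pairN a b) = a.
Proof. exact: component_join. Qed.

Lemma component_pair1 a b : component 1 (pairN a b) = b.
Proof. exact: component_join. Qed.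

Lemma continuous_id : continuousN id.
Proof. by move=> w i; exists i.+1 => v; apply. Qed.

Lemma continuous_component j g : continuousN g -> continuousN (fun w => component j (g w)).
Proof. by move=> cg w i; apply: cg. Qed.

Lemma continuous_proj j : continuousN (component j).
Proof. exact: continuous_component continuous_id. Qed.

Lemma continuous_proj2 j k : continuousN (fun p => component j (component k p)).
Proof. exact: continuous_component (continuous_proj k). Qed.

Lemma continuous_join (g : nat -> (nat -> nat) -> nat -> nat) :
  (forall j, continuousN (g j)) -> continuousN (fun w => join (fun j => g j w)).
Proof.
move=> cg w n; rewrite /join; case: (unpickle n) => [[j i]|]; first exact: cg.
by exists 0.
Qed.

Lemma continuous_pair g h : continuousN g -> continuousN h ->
  continuousN (fun w => pairN (g w) (h w)).
Proof. by move=> cg ch; apply: (@continuous_join (fun j w => if j is 0 then g w else h w)) => -[]. Qed.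

Lemma continuous_comp g h : continuousN g -> continuousN h -> continuousN (g \o h).
Proof.
move=> cg ch w i; have [m hm] := cg (h w) i.
have [n hn] := continuousN_agree ch w m.
by exists n => v /hn; apply: hm.
Qed.

Definition closedN (L : (nat -> nat) -> Prop) : Prop :=
  forall w, (forall n, exists v, agree n w v /\ L v) -> L w.

Lemma closedN_preimage L g : closedN L -> continuousN g -> closedN (fun w => L (g w)).
Proof.
move=> cL cg w hw; apply: cL => n; have [m hm] := continuousN_agree cg w n.
by have [v [/hm gv Lv]] := hw m; exists (g v).
Qed.

Lemma closedN_all (I : Type) (L : I -> (nat -> nat) -> Prop) :
  (forall i, closedN (L i)) -> closedN (fun w => forall i, L i w).
Proof.
move=> cL w hw i; apply: cL => n; have [v [wv Lv]] := hw n.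
by exists v.
Qed.

(** Projections of closed sets, that is, analytic sets. *)
Definition suslin (P : (nat -> nat) -> Prop) : Prop :=
  exists2 L, closedN L & forall w, P w <-> exists u, L (pairN w u).

Lemma suslin_ext (P Q : (nat -> nat) -> Prop) :
  (forall w, P w <-> Q w) -> suslin P -> suslin Q.
Proof. by move=> PQ [L cL PL]; exists L => // w; rewrite -PQ. Qed.

Lemma suslin_closed (L : (nat -> nat) -> Prop) : closedN L -> suslin L.
Proof.
move=> cL; exists (fun p => L (component 0 p)).
  by apply: closedN_preimage => //; apply: continuous_proj.
move=> w; split=> [Lw|[u]]; last by rewrite component_pair0.
by exists w; rewrite component_pair0.
Qed.

Lemma suslin_preimage P g : suslin P -> continuousN g -> suslin (fun w => P (g w)).
Proof.
move=> [L cL PL] cg.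
exists (fun p => L (pairN (g (component 0 p)) (component 1 p))).
  apply: closedN_preimage => //; apply: continuous_pair.
    exact: (continuous_comp cg (continuous_proj 0)).
  exact: continuous_proj.
move=> w; rewrite PL; split=> -[u Lu]; exists u; move: Lu;
  by rewrite component_pair0 component_pair1.
Qed.

Lemma suslin_all (P : nat -> (nat -> nat) -> Prop) :
  (forall n, suslin (P n)) -> suslin (fun w => forall n, P n w).
Proof.
move=> sP; have [L LP] : {L | forall n, closedN (L n) /\
    forall w, P n w <-> exists u, L n (pairN w u)}.
  apply: cid; have /choice[L hL] : forall n, exists L, closedN L /\
    forall w, P n w <-> exists u, L (pairN w u).
    by move=> n; have [L] := sP n; exists L.
  by exists L.
exists (fun p => forall n, L n (pairN (component 0 p) (component n (component 1 p)))).
  apply: closedN_all => n; apply: closedN_preimage; first exact: (LP n).1.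
  by apply: continuous_pair; [apply: continuous_proj|apply: continuous_proj2].
move=> w; split=> [Pw|[u Lu] n]; last first.
  apply/(LP n).2; have := Lu n; rewrite component_pair0 component_pair1.
  by exists (component n u).
have /choice[u Lu] : forall n, exists u, L n (pairN w u).
  by move=> n; apply/(LP n).2.
by exists (join u) => n; rewrite component_pair0 component_pair1 component_join.
Qed.

(** The index of the set is carried by the witness; it is a single coordinate, so it
    is constant on a neighbourhood. *)
Lemma suslin_exn (P : nat -> (nat -> nat) -> Prop) :
  (forall n, suslin (P n)) -> suslin (fun w => exists n, P n w).
Proof.
move=> sP; have [L LP] : {L | forall n, closedN (L n) /\
    forall w, P n w <-> exists u, L n (pairN w u)}.
  apply: cid; have /choice[L hL] : forall n, exists L, closedN L /\
    forall w, P n w <-> exists u, L (pairN w u).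
    by move=> n; have [L] := sP n; exists L.
  by exists L.
pose idx p := component 1 (component 1 p) 0.
pose arg p := pairN (component 0 p) (component 0 (component 1 p)).
have c_arg : continuousN arg.
  by apply: continuous_pair; [apply: continuous_proj|apply: continuous_proj2].
exists (fun p => L (idx p) (arg p)).
  move=> p hp; apply: (LP _).1 => n.
  have [m hm] := continuousN_agree c_arg p n.
  have [k hk] := continuous_proj2 1 1 p 0.
  have [q [pq Lq]] := hp (maxn m k); exists (arg q); split.
    by apply: hm; apply: agree_le pq; exact: leq_maxl.
  suff -> : idx p = idx q by [].
  by apply: hk; apply: agree_le pq; exact: leq_maxr.
move=> w; split=> [[n /(LP n).2[u Lu]]|[u Lu]].
  exists (pairN u (fun=> n)).
  by rewrite /idx /arg component_pair1 component_pair1 !component_pair0.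
exists (component 1 u 0); apply/(LP _).2; exists (component 0 u).
by move: Lu; rewrite /idx /arg !component_pair1 component_pair0.
Qed.

Lemma suslin_exN (P : (nat -> nat) -> Prop) :
  suslin P -> suslin (fun w => exists v, P (pairN w v)).
Proof.
move=> [L cL PL].
exists (fun p => L (pairN (pairN (component 0 p) (component 0 (component 1 p)))
                          (component 1 (component 1 p)))).
  apply: closedN_preimage => //.
  apply: continuous_pair; last exact: continuous_proj2.
  by apply: continuous_pair; [apply: continuous_proj|apply: continuous_proj2].
move=> w; split=> [[v /PL[u Lu]]|[u]].
  by exists (pairN v u); rewrite !(component_pair0, component_pair1).
rewrite component_pair0 component_pair1 => Lu.
by exists (component 0 u); apply/PL; exists (component 1 u).
Qed.

Lemma suslin_and (P Q : (nat -> nat) -> Prop) :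
  suslin P -> suslin Q -> suslin (fun w => P w /\ Q w).
Proof.
move=> sP sQ; apply: (suslin_ext (P := fun w => forall n, if n is 0 then P w else Q w)).
  by move=> w; split=> [h|[? ?] []//]; split; [apply: (h 0)|apply: (h 1)].
by apply: suslin_all => -[].
Qed.

(** The sets which are Suslin together with their complements form a sigma-algebra. *)
Lemma suslin_borel (B : set (nat -> nat)) : baire_borel B -> suslin B.
Proof.
suff : baire_borel `<=` [set B | suslin B /\ suslin (~` B)] by move=> /[apply] -[].
apply: smallest_sub.
  split=> /=.
  - split; apply: suslin_closed => w hw; last by [].
    by have [v [_ Lv]] := hw 0.
  - by move=> A [sA sCA]; rewrite setTD setCK.
  - move=> A hA; split.
      apply: (suslin_ext (P := fun w => exists n, A n w)).
        by move=> w; split=> [[n]|[n _]]; exists n.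
      by apply: suslin_exn => n; have [] := hA n.
    apply: (suslin_ext (P := fun w => forall n, ~ A n w)).
      by move=> w; split=> [h [n _]|h n An]; [apply: h|apply: h; exists n].
    by apply: suslin_all => n; have [] := hA n.
move=> _ [n _ [C _ <-]]; rewrite setTI.
have cl (A : set nat) : closedN (fun w => A (w n)).
  by move=> w hw; have [v [wv]] := hw n.+1; rewrite wv.
by split; apply: suslin_closed; [apply: cl|apply: (cl (~` C))].
Qed.

Lemma suslin_allC (I : countType) (P : I -> (nat -> nat) -> Prop) :
  (forall i, suslin (P i)) -> suslin (fun w => forall i, P i w).
Proof.
move=> sP; apply: (suslin_ext
  (P := fun w => forall n, if unpickle n is Some i then P i w else True)).
  move=> w; split=> [h i|h n]; first by have := h (pickle i); rewrite pickleK.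
  by case: unpickle.
apply: suslin_all => n; case: unpickle => [i //|].
by apply: suslin_closed.
Qed.

Lemma suslin_imp (C : Prop) (P : (nat -> nat) -> Prop) :
  suslin P -> suslin (fun w => C -> P w).
Proof.
move=> sP; have [c|nc] := pselect C.
  by apply: suslin_ext sP => w; split=> // h; apply: h.
by apply: suslin_ext (suslin_closed (L := fun=> True) _) => // w; split.
Qed.

Lemma closedN_coordinate g (i : nat) (C : set nat) :
  continuousN g -> closedN (fun w => C (g w i)).
Proof.
move=> cg w hw; have [n hn] := cg w i; have [v [wv Cv]] := hw n.
by rewrite (hn v wv).
Qed.

Lemma join_agree n : exists m, forall u u' : nat -> nat -> nat,
  (forall j, agree m (u j) (u' j)) -> agree n (join u) (join u').
Proof.
pose ix k := odflt (0, 0) (unpickle k : option (nat * nat)).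
exists (\max_(k < n) (ix k).2.+1) => u u' uu' k kn; rewrite /join.
case kE : (unpickle k) => [[j i]|] //; apply: uu'.
have := leq_bigmax (F := fun k : 'I_n => (ix k).2.+1) (Ordinal kn).
by rewrite /= /ix kE.
Qed.

Lemma baire_sigma : sigma_algebra setT baire_borel.
Proof. exact: smallest_sigma_algebra. Qed.

Lemma baire_borel_open (O : (nat -> nat) -> Prop) :
  (forall w, O w -> exists n, forall v, agree n w v -> O v) -> baire_borel [set w | O w].
Proof.
move=> openO.
apply: (borel_ext (SX := baire_borel) (P := fun w => exists s : seq nat,
  (forall v, agree (size s) (nth 0 s) v -> O v) /\ agree (size s) (nth 0 s) w)).
  move=> w; split=> [[s [sO /sO]]//|Ow]; have [n hn] := openO w Ow.
  have wn : agree n w (nth 0 (mkseq w n)) by move=> i ltin; rewrite nth_mkseq.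
  exists (mkseq w n); rewrite size_mkseq; split; last exact: agree_sym.
  by move=> v sv; apply: hn; apply: agree_trans sv.
apply: (borel_exC baire_sigma) => s; apply: (borel_and baire_sigma).
  exact: (borel_const baire_sigma).
apply: (borel_all baire_sigma) => i; apply: (borel_imp baire_sigma).
  exact: (borel_const baire_sigma).
apply: (borel_ext (SX := baire_borel) (P := fun w => w i = nth 0 s i)); first by move=> w; split.
have /(borel_map_baireP baire_sigma) := fun B (h : baire_borel B) => h : baire_borel (id @^-1` B).
exact.
Qed.

Lemma borel_continuousN g : continuousN g -> borel_map baire_borel baire_borel g.
Proof.
move=> cg; apply/(borel_map_baireP baire_sigma) => n m; apply: baire_borel_open => w <-.
by have [k hk] := cg w n; exists k => v /hk.
Qed.

(** * Separation of images in a standard Borel space *)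

(** All that is used of a Polish topology.  The last clause expresses that [f] is
    continuous for a Hausdorff topology with Borel open sets. *)
Record suslin_param (X : Type) (SX : set (set X)) (f : (nat -> nat) -> X) : Prop := {
  sp_surj : forall x, exists w, f w = x ;
  sp_borel : borel_map baire_borel SX f ;
  sp_separating : forall w v, f w <> f v -> exists m D,
    [/\ SX D, forall w', agree m w w' -> D (f w')
      & forall v', agree m v v' -> ~ D (f v')]
}.

Section Separation.
Variables (X : Type) (SX : set (set X)) (f : (nat -> nat) -> X).
Hypotheses (sX : sigma_algebra setT SX) (hf : suslin_param SX f).

(** The classical argument: if the two images cannot be separated, then neither can
    the images of some pair of pieces obtained by fixing one more coordinate of the
    witnesses, because countable unions of separable pieces are separable.  The limit is
    a pair of points in the two sets; these are distinct, and neighbourhoods of them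
    separate the corresponding pieces after all. *)
Lemma suslin_separation (P Q : (nat -> nat) -> Prop) : suslin P -> suslin Q ->
  (forall w v, P w -> Q v -> f w <> f v) ->
  exists D, [/\ SX D, forall w, P w -> D (f w) & forall w, Q w -> ~ D (f w)].
Proof.
move=> [L cL PL] [M cM QM] disj; apply: contrapT => insep0.
pose sep n (a : nat -> nat * nat) := exists D, [/\ SX D,
  forall w u, agree n (fst \o a) (pairN w u) -> L (pairN w u) -> D (f w) &
  forall w u, agree n (snd \o a) (pairN w u) -> M (pairN w u) -> ~ D (f w)].
have [|||a ha] := @fusion _ (fun n a => ~ sep n a) (fun=> (0, 0)).
- move=> n a b ab; apply: contra_not => -[D [SD h1 h2]].
  by exists D; split=> // w u h; [apply: (h1 w u)|apply: (h2 w u)] => i ltin;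
    rewrite /= -ab //; apply: h.
- apply: contra_not insep0 => -[D [SD h1 h2]]; exists D; split=> // w.
    by move=> /PL[u]; apply: h1.
  by move=> /QM[u]; apply: h2.
- move=> n a nsep; apply: contrapT => no; apply: nsep.
  pose b i j k := if k == n then (i, j) else a k.
  have : forall ij, exists D, [/\ SX D,
    forall w u, agree n.+1 (fst \o b ij.1 ij.2) (pairN w u) -> L (pairN w u) -> D (f w) &
    forall w u, agree n.+1 (snd \o b ij.1 ij.2) (pairN w u) -> M (pairN w u) -> ~ D (f w)].
    move=> [i j]; apply: contrapT => nb; apply: no; exists (b i j); split=> //.
    by move=> k kn; rewrite /b ltn_eqF.
  move=> /choice[D hD]; exists [set x | exists i, forall j, D (i, j) x]; split.
  + apply: (borel_ex sX) => i; apply: (borel_all sX) => j.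
    by have [] := hD (i, j).
  + move=> w u wu Lwu; exists (pairN w u n) => j; have [_ h _] := hD (pairN w u n, j).
    apply: (h w u) => // k; rewrite ltnS /= /b; have [->//|kn] := eqVneq k n.
    by move=> kn'; apply: wu; rewrite ltn_neqAle kn.
  + move=> w u wu Lwu [i]; have [_ _ h] := hD (i, pairN w u n).
    move=> /(_ (pairN w u n)); apply: (h w u) => // k.
    rewrite ltnS /= /b; have [->//|kn] := eqVneq k n.
    by move=> kn'; apply: wu; rewrite ltn_neqAle kn.
(* The limit of codes of pairs need not be the code of a pair; [rep] normalises it. *)
pose rep p := pairN (component 0 p) (component 1 p).
have c_rep : continuousN rep.
  by apply: continuous_pair; apply: continuous_proj.
have repE w u : rep (pairN w u) = pairN w u.
  by rewrite /rep component_pair0 component_pair1.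
have lim_in (K : (nat -> nat) -> Prop) p : closedN K ->
    (forall n, exists w u, agree n p (pairN w u) /\ K (pairN w u)) -> K (rep p).
  move=> cK hp; apply: cK => n; have [m hm] := continuousN_agree c_rep p n.
  by have [w [u [/hm]]] := hp m; rewrite repE; exists (pairN w u).
have Pa : P (component 0 (fst \o a)).
  apply/PL; exists (component 1 (fst \o a)); apply: (lim_in L (fst \o a)) => // n.
  apply: contrapT => no; apply: (ha n); exists set0; split=> [|w u h1 h2|? ? _ _ []].
    exact: (borel_const sX False).
  by apply: no; exists w, u.
have Qa : Q (component 0 (snd \o a)).
  apply/QM; exists (component 1 (snd \o a)); apply: (lim_in M (snd \o a)) => // n.
  apply: contrapT => no; apply: (ha n); exists setT; split=> [|//|w u h1 h2 _].
    exact: (borel_const sX True).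
  by apply: no; exists w, u.
have [m [D [SD hP hQ]]] := sp_separating hf (disj _ _ Pa Qa).
have [n hn] := continuousN_agree (continuous_proj 0) (fst \o a) m.
have [k hk] := continuousN_agree (continuous_proj 0) (snd \o a) m.
apply: (ha (maxn n k)); exists D; split=> // w u wu _.
  by apply: hP; rewrite -(component_pair0 w u); apply: hn; apply: agree_le wu; exact: leq_maxl.
by apply: hQ; rewrite -(component_pair0 w u); apply: hk; apply: agree_le wu; exact: leq_maxr.
Qed.

Variable E : X -> X -> Prop.
Hypothesis hE : countable_borel_equivalence SX E.

Lemma suslin_equivalence : suslin (fun p => E (f (component 0 p)) (f (component 1 p))).
Proof.
apply: (suslin_borel (B := (fun p => (f (component 0 p), f (component 1 p))) @^-1`
                           [set q | E q.1 q.2])).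
apply: (_ : borel_map baire_borel (prod_borel SX SX) _) (cber_borel hE).
have bf j : borel_map baire_borel SX (fun p => f (component j p)).
  move=> B /(sp_borel hf); apply: borel_continuousN.
  exact: continuous_proj.
apply: (borel_map_generated baire_sigma) => _ [] [B SB <-]; rewrite setTI.
  exact: (bf 0).
exact: (bf 1).
Qed.

Definition saturation (P : (nat -> nat) -> Prop) (w : nat -> nat) : Prop :=
  exists v, E (f w) (f v) /\ P v.

Lemma suslin_saturation P : suslin P -> suslin (saturation P).
Proof.
move=> sP; pose R p := E (f (component 0 p)) (f (component 1 p)) /\ P (component 1 p).
apply: (suslin_ext (P := fun w => exists v, R (pairN w v))).
  have RE w v : R (pairN w v) = (E (f w) (f v) /\ P v).
    by rewrite /R component_pair0 component_pair1.
  by move=> w; split=> -[v]; [rewrite RE|rewrite -RE]; exists v.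
apply/suslin_exN/suslin_and; first exact: suslin_equivalence.
by apply: suslin_preimage => //; apply: continuous_proj.
Qed.

(** Closing a separating set under the equivalence relation gives a Suslin set that
    still avoids the saturation of [Q]; separating again and iterating [omega] times, the
    union is both Borel and invariant. *)
Lemma invariant_separation (P Q : (nat -> nat) -> Prop) : suslin P -> suslin Q ->
  (forall w v, P w -> Q v -> ~ E (f w) (f v)) ->
  exists D, [/\ SX D, forall x y, E x y -> D x -> D y,
    forall w, P w -> D (f w) & forall w, Q w -> ~ D (f w)].
Proof.
move=> sP sQ disj.
have symE := @cber_sym _ _ _ hE; have transE := @cber_trans _ _ _ hE.
have reflE := @cber_refl _ _ _ hE.
pose good := {D | SX D /\ forall w, saturation Q w -> ~ D (f w)}.
have step (D : good) : {D' : good | forall x y, E x y -> sval D x -> sval D' y}.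
  case: D => D [SD DQ]; apply: cid.
  have [|||D' [SD' h1 h2]] := @suslin_separation (saturation (fun v => D (f v))) (saturation Q).
  - apply: suslin_saturation; apply: suslin_borel (f @^-1` D) _.
    exact: (sp_borel hf).
  - exact: suslin_saturation.
  - move=> w v [w' [ww' Dw']] [v' [vv' Qv']] wv.
    apply: (DQ w') => //; exists v'; split=> //.
    by apply: transE vv'; rewrite -wv; apply: symE.
  exists (exist _ D' (conj SD' h2)) => x y xy /= Dx.
  have [w wx] := sp_surj hf x; have [v vy] := sp_surj hf y.
  by rewrite -vy; apply: h1; exists w; rewrite wx vy; split=> //; apply: symE.
have [|||D0 [SD0 h1 h2]] := @suslin_separation P (saturation Q) => //.
- exact: suslin_saturation.
- by move=> w v Pw [v' [vv' Qv']] wv; apply: (disj w v') => //; rewrite wv.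
have [D [D0E DS]] := dependent_choice step (exist _ D0 (conj SD0 h2)).
exists [set x | exists n, sval (D n) x]; split.
- by apply: (borel_ex sX) => n; have [] := svalP (D n).
- by move=> x y xy [n Dn]; exists n.+1; apply: DS Dn.
- by move=> w Pw; exists 0; rewrite D0E; apply: h1.
- move=> w Qw [n]; have [_ h] := svalP (D n); apply: h.
  by exists w.
Qed.

End Separation.

(** * Parametrising a standard Borel space by Baire space *)

Section PolishParametrisation.
Import Order.TTheory GRing.Theory Num.Theory numFieldNormedType.Exports.
Local Open Scope ring_scope.
Variables (R : realType) (P : metricType R).
Variable d : nat -> P.
Hypothesis d_dense : forall p (e : R), 0 < e -> exists n, ball p e (d n).
Hypothesis complete : forall F : set_system P, ProperFilter F -> cauchy F ->
  exists p : P, F --> p.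

Let r (n : nat) : R := 2^-1 ^+ n.

Let r_gt0 n : 0 < r n. Proof. by rewrite exprn_gt0 // invr_gt0. Qed.

Let rS n : r n = r n.+1 + r n.+1.
Proof. by rewrite /r exprS mulrC -splitr. Qed.

Let r_small (e : R) : 0 < e -> exists n, r n < e.
Proof.
move=> e0; have h : `|2^-1 : R| < 1 by rewrite ger0_norm ?invr_ge0 // invf_lt1 // ltr1n.
have [n _ hn] := (cvg_ballP _ _).1 (cvg_expr h) e e0.
exists n; have := hn n (leqnn n); rewrite /ball /= sub0r normrN ger0_norm //.
Qed.

(** A code [w] lists points of the dense sequence, and entries that would jump too far
    are ignored.  Every code thus gives a Cauchy sequence, which makes the
    parametrisation total. *)
Fixpoint approx (w : nat -> nat) (n : nat) : P :=
  if n is m.+1 then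
    if `[< ball (approx w m) (r m) (d (w n)) >] then d (w n) else approx w m
  else d (w 0%N).

Lemma ball_approxS w n : ball (approx w n) (r n) (approx w n.+1).
Proof. by rewrite /=; case: asboolP => // _; apply: ballxx. Qed.

Lemma ball_approx w m n : (m <= n)%N -> ball (approx w m) (r m + r m) (approx w n).
Proof.
move=> /subnK <-; move: (n - m)%N => k; elim: k m => [|k IH] m.
  by apply: ballxx; rewrite addr_gt0.
rewrite addSn -addnS; apply: ball_triangle (ball_approxS w m) _.
by rewrite [X in ball _ X]rS; apply: IH.
Qed.

Lemma cauchy_approx w : cauchy (approx w @ \oo).
Proof.
apply: cauchy_exP => e e0; have [n hn] := r_small e0.
exists (approx w n.+1); exists n.+1 => // m /= nm.
by apply: le_ball (ball_approx w nm); rewrite -rS ltW.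
Qed.

Lemma approx_limit : {l : (nat -> nat) -> P | forall w, approx w @ \oo --> l w}.
Proof.
have [l hl] := choice (fun w => complete (fmap_proper_filter _ _) (@cauchy_approx w)).
by exists l.
Qed.

Section Limit.
Variable l : (nat -> nat) -> P.
Hypothesis cvg_l : forall w, approx w @ \oo --> l w.

Lemma ball_limit w n : ball (approx w n) (r n + r n + r n) (l w).
Proof.
have [m _ hm] := (cvg_ballP _ _).1 (@cvg_l w) (r n) (r_gt0 n).
apply: ball_triangle (ball_approx w (leq_maxl n m)) (ball_sym _).
exact: hm (leq_maxr n m).
Qed.

Lemma eq_approx w v n : agree n.+1 w v -> approx w n = approx v n.
Proof.
elim: n => [|n IH] wv /=; first by rewrite wv.
by rewrite IH ?wv // => i ltin; apply: wv; apply: ltnW.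
Qed.

Lemma limit_continuous (U : set P) w : open U -> U (l w) ->
  exists n, forall v, agree n w v -> U (l v).
Proof.
rewrite openE => /[apply] /nbhs_ballP[e /= e0 eU].
have [n hn] := r_small (divr_gt0 e0 (ltr0n R 6)).
exists n.+1 => v /eq_approx wv; apply: eU.
apply: le_ball (ball_triangle (ball_sym (ball_limit w n)) _); last first.
  by rewrite wv; apply: ball_limit.
by move: hn; rewrite ltr_pdivlMr ?ltr0n //; move: (r n) => x; lra.
Qed.

(** A code that follows [p] at distance [r k.+2] is never corrected. *)
Lemma limit_surj p : exists w, l w = p.
Proof.
have /choice[w wp] : forall k, exists m, ball p (r k.+2) (d m).
  by move=> k; apply: d_dense.
have wE k : approx w k = d (w k).
  elim: k => //= k ->; case: asboolP => // nb; case: nb.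
  apply: le_ball (ball_triangle (ball_sym (wp k)) (wp k.+1)).
  have := r_gt0 k.+3; rewrite (rS k) (rS k.+1) (rS k.+2).
  by move: (r k.+3) => x; lra.
exists w; apply: (cvg_unique (@metric_hausdorff R P)) (@cvg_l w) _.
apply/cvg_ballP => e e0; have [n hn] := r_small e0.
exists n => // k /= nk; rewrite wE; apply: le_ball (wp k).
apply: le_trans (ltW hn); apply: ler_wiXn2l; last by rewrite ltnW // ltnW.
  by rewrite invr_ge0.
by rewrite invf_le1 // ler1n.
Qed.

End Limit.

End PolishParametrisation.

(** Only the measurable structure of [X] is given, so the parametrisation is transported
    along a Borel isomorphism with a Polish space. *)
Lemma standard_borel_param (X : Type) (SX : set (set X)) (x0 : X) :
  standard_borel SX -> exists f, suslin_param SX f.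
Proof.
move=> [R [P [g [[[D cD dD] complete] bij_g ->]]]].
have [d dP] : exists d : nat -> P, forall p, D p -> exists n, d n = p.
  have /countable_injP[i inj_i] := cD.
  have /choice[d hd] : forall n, exists q, (exists2 p, D p & i p = n) -> D q /\ i q = n.
    move=> n; have [[p Dp ip]|no] := pselect (exists2 p, D p & i p = n); first by exists p.
    by exists (g x0) => h; case: no.
  exists d => p Dp; exists (i p); have [|Dd ip] := hd (i p); first by exists p.
  by apply: inj_i => //; apply: mem_set.
have d_dense p (e : R) : (0 < e)%R -> exists n, ball p e (d n).
  move=> e0; have := @open_nbhs_ball _ _ p (PosNum e0).
  rewrite open_nbhsE => -[oB /nbhs_singleton Bp].
  have [q [Bq /dP[n dn]]] := dD _ (ex_intro _ p Bp) oB.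
  by exists n; rewrite dn; apply: interior_subset Bq.
have [l lP] := approx_limit d complete.
have cont := limit_continuous lP.
case: bij_g => h gK hK; exists (h \o l); split.
- move=> x; have [w wE] := limit_surj d_dense lP (g x).
  by exists w; rewrite /= wE gK.
- move=> _ [B SB <-]; rewrite setTI.
  have : borel_map baire_borel <<s [set U : set P | open U] >> (l).
    apply: (borel_map_generated baire_sigma) => U oU; apply: baire_borel_open => w.
    exact: cont.
  move=> /(_ B SB); congr baire_borel; apply/seteqP; split=> w /=; by rewrite hK.
move=> w v wv; have {}wv : l w != l v by apply/eqP => e; apply: wv; rewrite /= e.
have := @metric_hausdorff R P; rewrite open_hausdorff => /(_ _ _ wv)[[A B] /= []].
rewrite !inE => Aw Bv [oA oB AB].
have [m hm] := cont A w oA Aw; have [n hn] := cont B v oB Bv.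
exists (maxn m n), (g @^-1` A); split.
- by exists A; [apply: sub_sigma_algebra|rewrite setTI].
- move=> w' ww' /=; rewrite hK; apply: hm; apply: agree_le ww'; exact: leq_maxl.
- move=> v' vv' /=; rewrite hK => Av'; move/seteqP: AB => [AB _].
  by apply: (AB (l v')); split=> //; apply: hn; apply: agree_le vv'; exact: leq_maxr.
Qed.

(** * A dichotomy for labelled Suslin graphs *)

Definition prefix_of (z : nat -> bool) (n : nat) : seq bool := mkseq z n.

Definition prepend (s : seq bool) (z : nat -> bool) : nat -> bool :=
  fun i => if i < size s then nth false s i else z (i - size s).

Lemma size_prefix z n : size (prefix_of z n) = n.
Proof. exact: size_mkseq. Qed.

Lemma prefix_of_add z m n :
  prefix_of z (m + n) = prefix_of z m ++ prefix_of (fun i => z (m + i)) n.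
Proof.
rewrite /prefix_of /mkseq iotaD map_cat; congr (_ ++ _).
by rewrite add0n -{1}[m]addn0 iotaDl -map_comp.
Qed.

Lemma prefix_of_agree m n z z' : m <= n -> agree n z z' -> prefix_of z m = prefix_of z' m.
Proof.
move=> mn zz'; apply/eq_in_map => i; rewrite mem_iota add0n => im.
by apply: zz'; apply: leq_trans mn.
Qed.

Lemma prefix_of_prepend s z n : prefix_of (prepend s z) (size s + n) = s ++ prefix_of z n.
Proof.
rewrite prefix_of_add; congr (_ ++ _).
  apply: (@eq_from_nth _ false) => [|i]; first by rewrite size_mkseq.
  by rewrite size_mkseq => im; rewrite nth_mkseq // /prepend im.
by apply/eq_map => i; rewrite /prepend ltnNge leq_addr /= addKn.
Qed.

Fixpoint bitseqs (n : nat) : seq (seq bool) :=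
  if n is m.+1 then map (rcons^~ false) (bitseqs m) ++ map (rcons^~ true) (bitseqs m)
  else [:: [::]].

Lemma mem_bitseqs s : s \in bitseqs (size s).
Proof.
elim/last_ind: s => // s b IH; rewrite size_rcons /=.
by rewrite mem_cat; case: b; rewrite (map_f (rcons^~ _)) ?orbT.
Qed.

(** Vertices and edge witnesses are points of Baire space ranging over closed sets, and
    the label of a vertex [v] is the sequence [m |-> v (lam m)] of some of its own
    coordinates.  The relation [kill t v] says that the parameter [t] accounts for the
    label of [v].  A configuration of level [n] attaches vertices to the binary
    sequences of length [n] and edges to the pairs that differ in one bit following
    [node k]; these pairs connect all sequences of length [n]. *)
Section Dichotomy.
Variables (vertex : (nat -> nat) -> Prop) (edge : (nat -> nat) -> (nat -> nat) -> (nat -> nat) -> Prop).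
Variable lam : nat -> nat.
Hypothesis closed_vertex : closedN vertex.
Hypothesis closed_edge : forall a b e,
  (forall n, exists a' b' e', [/\ agree n a a', agree n b b', agree n e e' & edge a' b' e']) ->
  edge a b e.
Variables (S : Type) (kill : S -> (nat -> nat) -> Prop).
Variable node : nat -> seq bool.
Hypothesis size_node : forall n, size (node n) = n.

(** The index [(None, s)] is that of the vertex at [s]; the index [(Some k, u)] is that of
    the edge between [node k ++ false :: u] and [node k ++ true :: u]. *)
Definition index : Type := (option nat * seq bool)%type.

Definition configuration : Type := index -> nat -> nat.

Implicit Types (c : configuration) (D : set S).

Definition proper (n : nat) c : Prop :=
  (forall s, size s = n -> vertex (c (None, s))) /\
  (forall k u, k + (size u).+1 = n ->
    edge (c (None, node k ++ false :: u)) (c (None, node k ++ true :: u)) (c (Some k, u))).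

(** A finite constraint is a list of prescribed values of coordinates, so there are only
    countably many. *)
Definition satisfies (p : seq (index * (nat * nat))) c : Prop :=
  forall q, q \in p -> c q.1 q.2.1 = q.2.2.

Definition avoids (n : nat) D c : Prop :=
  forall t s, D t -> size s = n -> ~ kill t (c (None, s)).

Definition admissible n p D c : Prop := [/\ proper n c, satisfies p c & avoids n D c].

(** The constraint can be realised outside of any countable family of parameters: this
    is largeness with respect to a sigma-ideal. *)
Definition live n p : Prop := forall D, countable D -> exists c, admissible n p D c.

Hypothesis root : forall D, countable D ->
  exists2 v, vertex v & forall t, D t -> ~ kill t v.

(** If the configurations subject to [p] never give two vertices at [node n] that are
    joined by an edge and have distinct labels, then one parameter accounts for all the
    labels at [node n]. *)
Hypothesis independent_killed : forall n p D, countable D ->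
  (forall c c' e, admissible n p D c -> admissible n p D c' ->
    edge (c (None, node n)) (c' (None, node n)) e ->
    forall m, c (None, node n) (lam m) = c' (None, node n) (lam m)) ->
  exists t, forall c, admissible n p D c -> kill t (c (None, node n)).

Definition branch (b : bool) c : configuration := fun j => c (j.1, rcons j.2 b).

(** Puts two configurations of level [n] side by side, distinguished by the last bit,
    with the new edge [e] joining their vertices at [node n]. *)
Definition glue (n : nat) (cs : bool -> configuration) (e : nat -> nat) : configuration :=
  fun j => if j == (Some n, [::]) then e
           else cs (last false j.2) (j.1, take (size j.2).-1 j.2).

Lemma glue_rcons n cs e o u b : glue n cs e (o, rcons u b) = cs b (o, u).
Proof.
rewrite /glue; case: eqP => [[_]|_] /=; first by case: u.
by rewrite last_rcons size_rcons -cats1 take_size_cat.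
Qed.

Lemma proper_glue n cs e : (forall b, proper n (cs b)) ->
  edge (cs false (None, node n)) (cs true (None, node n)) e -> proper n.+1 (glue n cs e).
Proof.
move=> pcs ce; split=> [s|k u].
  case/lastP: s => // s b; rewrite size_rcons glue_rcons => -[sn].
  exact: (pcs b).1.
case/lastP: u => [|u b].
  rewrite addn1 => -[->]; rewrite !cats1 !glue_rcons.
  by rewrite /glue eqxx.
rewrite size_rcons addnS => -[ku]; rewrite -!rcons_cons -!rcons_cat !glue_rcons.
exact: (pcs b).2.
Qed.

Lemma avoids_glue n D cs e : (forall b, avoids n D (cs b)) -> avoids n.+1 D (glue n cs e).
Proof.
move=> acs t s Dt; case/lastP: s => // s b; rewrite size_rcons glue_rcons => -[sn].
exact: acs.
Qed.

Definition relevant (n : nat) (j : index) : Prop :=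
  if j.1 is Some k then k + (size j.2).+1 = n else size j.2 = n.

Lemma relevant_finite n : exists l : seq index, forall j, relevant n j -> j \in l.
Proof.
exists ([seq (None, s) | s <- bitseqs n] ++
        [seq (Some k, u) | k <- iota 0 n, u <- bitseqs (n - k.+1)]).
move=> [[k|] u]; rewrite /relevant /= mem_cat => ju; apply/orP; [right|left].
  apply/allpairsPdep; exists k, u; split=> //=.
    by rewrite mem_iota add0n -ju -addSnnS leq_addr.
  by rewrite -ju -addSnnS addKn mem_bitseqs.
by apply/mapP; exists u => //; rewrite -ju mem_bitseqs.
Qed.

Definition lift (p : seq (index * (nat * nat))) (b : bool) :=
  [seq ((q.1.1, rcons q.1.2 b), q.2) | q <- p].

Lemma satisfies_lift p b c : satisfies (lift p b) c <-> satisfies p (branch b c).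
Proof.
split=> [h [[a u] q] pq|h _ /mapP[[[a u] q] pq ->]]; last exact: (h _ pq).
by apply: (h ((a, rcons u b), q)); apply/mapP; exists ((a, u), q).
Qed.

Lemma satisfies_cat p p' c : satisfies (p ++ p') c <-> satisfies p c /\ satisfies p' c.
Proof.
split=> [h|[h h'] q]; last by rewrite mem_cat => /orP[/h|/h'].
by split=> q pq; apply: h; rewrite mem_cat pq ?orbT.
Qed.

(** The three clauses give, in the limit: convergence to points satisfying all the
    constraints, existence of the limit, and distinct labels along the [n]-th edges. *)
Definition refines n p p' : Prop :=
  [/\ forall c b, satisfies p' c -> satisfies p (branch b c),
      forall c c' j i, relevant n.+1 j -> i < n.+1 ->
        satisfies p' c -> satisfies p' c' -> c j i = c' j i
    & exists m, forall c, satisfies p' c ->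
        c (None, rcons (node n) false) (lam m) <> c (None, rcons (node n) true) (lam m)].

(** As there are countably many constraints, one countable family is avoided only by
    configurations of live constraints. *)
Lemma countable_witness : exists2 D, countable D &
  forall n p, ~ live n p -> forall c, ~ admissible n p D c.
Proof.
have /choice[F hF] : forall np : nat * seq (index * (nat * nat)), exists D,
    countable D /\ (~ live np.1 np.2 -> forall c, ~ admissible np.1 np.2 D c).
  move=> [n p]; have [l|nl] := pselect (live n p).
    by exists set0; split=> //; apply: countable0.
  move/existsNP: (nl) => [D /not_implyP[cD noc]]; exists D; split=> // _ c ac.
  by apply: noc; exists c.
exists (\bigcup_np F np).
  by apply: bigcup_countable => [|np _]; [exact: countableP|have [] := hF np].
move=> n p nl c [pc sc ac]; have [_ h] := hF (n, p); apply: (h nl c); split=> //.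
by move=> t s Ft; apply: ac; exists (n, p).
Qed.

(** Outside of the universal countable family, some two configurations subject to [p]
    can be glued along an edge with distinct labels: otherwise [independent_killed] gives
    one more parameter, and avoiding it as well contradicts that [p] is live.  The refined
    constraint records enough coordinates of the glued configuration. *)
Lemma live_refine n p : live n p -> exists2 p', live n.+1 p' & refines n p p'.
Proof.
move=> lp; have [D cD hD] := countable_witness; apply: contrapT => no.
have [c c' e ac ac' cc' m|t kt] := @independent_killed n p D cD; last first.
  have cD' : countable (D `|` [set t]).
    rewrite (_ : _ `|` _ = \bigcup_(b in [set: bool]) if b then D else [set t]); last first.
      apply/seteqP; split=> u; first by case=> Du; [exists true|exists false].
      by case=> -[] _ Du; [left|right].
    by apply: bigcup_countable => [|[] _]; [exact: countableP|exact: cD|exact: countable1].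
  have [c [pc sc av]] := lp _ cD'; apply: (av t (node n)) => //; first by right.
  by apply: kt; split=> // t' s Dt'; apply: av; left.
apply: contrapT => ne; apply: no.
pose cs b := if b then c' else c.
have acs b : admissible n p D (cs b) by case: b.
pose g := glue n cs e.
have gB b : branch b g = cs b.
  by apply/funext => -[a u]; rewrite /branch /g glue_rcons.
have [l hl] := relevant_finite n.+1.
pose at_ j i := (j : index, (i : nat, g j i)).
pose p' := lift p false ++ lift p true ++ [seq at_ j i | j <- l, i <- iota 0 n.+1] ++
  [:: at_ (None, rcons (node n) false) (lam m); at_ (None, rcons (node n) true) (lam m)].
have sg : satisfies p' g.
  rewrite /p' !satisfies_cat !satisfies_lift !gB; split; first by have [] := acs false.
  split; first by have [] := acs true.
  split=> [_ /allpairsPdep[j [i [_ _ ->]]]//|q].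
  by rewrite !inE => /orP[] /eqP ->.
exists p'.
  apply: contrapT => /hD/(_ g); apply; split=> //.
    by apply: proper_glue => // b; have [] := acs b.
  by apply: avoids_glue => b; have [] := acs b.
split.
- by move=> d b; rewrite /p' !satisfies_cat !satisfies_lift => -[? [? _]]; case: b.
- move=> d d' j i /hl jl ltin; rewrite /p' !satisfies_cat => -[_ [_ [h _]]] [_ [_ [h' _]]].
  have inl : at_ j i \in [seq at_ j i | j <- l, i <- iota 0 n.+1].
    by apply/allpairsPdep; exists j, i; split; rewrite ?mem_iota.
  by rewrite (h _ inl) (h' _ inl).
- exists m => d; rewrite /p' !satisfies_cat => -[_ [_ [_ h]]].
  rewrite (h (at_ (None, rcons (node n) false) (lam m))) ?inE ?eqxx //.
  rewrite (h (at_ (None, rcons (node n) true) (lam m))) ?inE ?eqxx ?orbT //=.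
  by rewrite /g !glue_rcons.
Qed.

Lemma live_root : live 0 [::].
Proof.
move=> D cD; have [v vv nk] := root cD; exists (fun=> v); split=> //.
  by split=> [//|k u]; rewrite addnS.
by move=> t s Dt _; apply: nk.
Qed.

(** The limit of a sequence of refinements.  The value of [V] at [z] is read off from the
    vertices at the initial segments of [z] in realisations of the successive constraints. *)
Theorem dichotomy_embedding : exists V : (nat -> bool) -> nat -> nat,
  [/\ forall n z z', agree n z z' -> agree n (V z) (V z'),
      forall z, vertex (V z),
      forall k w, exists e,
        edge (V (prepend (rcons (node k) false) w)) (V (prepend (rcons (node k) true) w)) e
    & forall k w, exists m, V (prepend (rcons (node k) false) w) (lam m) <>
                            V (prepend (rcons (node k) true) w) (lam m)].
Proof.
have /choice[F hF] : forall np : nat * seq (index * (nat * nat)), exists p',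
    live np.1 np.2 -> live np.1.+1 p' /\ refines np.1 np.2 p'.
  move=> [n p]; have [/live_refine[p' l r]|nl] := pselect (live n p); first by exists p'.
  by exists [::].
pose p_ := fix p_ n := if n is m.+1 then F (m, p_ m) else [::].
have lp n : live n (p_ n).
  by elim: n => [|n IH]; [exact: live_root|have [] := hF (n, p_ n) IH].
have rp n : refines n (p_ n) (p_ n.+1) by have [] := hF (n, p_ n) (lp n).
have /choice[c hc] : forall n, exists c, proper n c /\ satisfies (p_ n) c.
  by move=> n; have [|c [pc sc _]] := lp n set0; [exact: countable0|exists c].
(* [tail t d] is the level [n] part of [d] lying below the final segment [t]. *)
pose tail t (d : configuration) : configuration := fun j => d (j.1, j.2 ++ t).
have sat_tail t n d : satisfies (p_ (n + size t)) d -> satisfies (p_ n) (tail t d).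
  elim: t n => [|b t IH] n /=.
    rewrite addn0; suff -> : tail [::] d = d by [].
    by apply/funext => -[a u]; rewrite /tail cats0.
  rewrite -addSnnS => /IH sd; have [h _ _] := rp n.
  suff <- : branch b (tail t d) = tail (b :: t) d by apply: h.
  by apply/funext => -[a u]; rewrite /branch /tail /= cat_rcons.
have coh n t j i : relevant n j -> i < n -> c (n + size t) (j.1, j.2 ++ t) i = c n j i.
  case: n => // n rj ltin; have [_ h _] := rp n.
  have s1 : satisfies (p_ n.+1) (tail t (c (n.+1 + size t))).
    by apply: sat_tail; have [] := hc (n.+1 + size t).
  by apply: (h (tail t (c (n.+1 + size t))) (c n.+1) j i) => //; have [] := hc n.+1.
pose V z i := c i.+1 (None, prefix_of z i.+1) i.
have VE z n i : i < n -> V z i = c n (None, prefix_of z n) i.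
  move=> ltin; rewrite -(subnKC ltin) prefix_of_add.
  set t := prefix_of (fun k => z (i.+1 + k)) _; have szt : size t = n - i.+1 by rewrite size_prefix.
  rewrite -szt (coh i.+1 t (None, prefix_of z i.+1)) //.
  exact: size_prefix.
have VA z n : agree n (V z) (c n (None, prefix_of z n)) by move=> i; apply: VE.
exists V; split.
- move=> n z z' zz' i ltin; rewrite /V; congr (c _ (_, _) _).
  exact: prefix_of_agree zz'.
- move=> z; apply: closed_vertex => n; exists (c n (None, prefix_of z n)); split=> //.
  by have [[h _] _] := hc n; apply: h; rewrite size_prefix.
- move=> k w; pose eps i := c (k.+1 + i) (Some k, prefix_of w i) i.
  exists eps; apply: closed_edge => n; pose L := k.+1 + n.
  have nL : n <= L by rewrite leq_addl.
  have preL b : prefix_of (prepend (rcons (node k) b) w) L = node k ++ b :: prefix_of w n.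
    rewrite -cat_rcons -prefix_of_prepend /L.
    by rewrite size_rcons size_node.
  exists (c L (None, node k ++ false :: prefix_of w n)),
         (c L (None, node k ++ true :: prefix_of w n)), (c L (Some k, prefix_of w n)).
  split.
  + by rewrite -preL; apply: agree_le (VA _ L).
  + by rewrite -preL; apply: agree_le (VA _ L).
  + move=> i ltin; rewrite /eps /L -(subnKC (ltnW ltin)) prefix_of_add addnA.
    set t := prefix_of (fun k0 => w (i + k0)) _; have szt : size t = n - i by rewrite size_prefix.
    rewrite -szt (coh (k.+1 + i) t (Some k, prefix_of w i)) //.
      by change (k + (size (prefix_of w i)).+1 = k.+1 + i); rewrite size_prefix addnS.
    by rewrite ltnS leq_addl.
  + have [[_ h] _] := hc L; apply: h.
    by rewrite size_prefix /L addnS addSn.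
- move=> k w; have [_ _ [m hm]] := rp k; exists m.
  pose L := k.+1 + (lam m).+1.
  have Vk b : V (prepend (rcons (node k) b) w) (lam m) =
      tail (prefix_of w (lam m).+1) (c L) (None, rcons (node k) b) (lam m).
    rewrite (VE _ L) ?leq_addl // /tail /= -prefix_of_prepend size_rcons size_node.
    by [].
  rewrite !Vk; apply: hm; apply: sat_tail; rewrite size_prefix.
  by have [] := hc L.
Qed.

End Dichotomy.

(** * Baire category on Cantor space *)

Definition nowhere_dense (F : set (nat -> bool)) : Prop :=
  forall z n, exists z' m, [/\ n <= m, agree n z z' & forall v, agree m z' v -> ~ F v].

Definition meager (M : set (nat -> bool)) : Prop :=
  exists2 F : nat -> set (nat -> bool),
    forall i, nowhere_dense (F i) & M `<=` \bigcup_i F i.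

Lemma sub_meager (M M' : set (nat -> bool)) : M `<=` M' -> meager M' -> meager M.
Proof. by move=> MM [F ndF M'F]; exists F => //; apply: subset_trans M'F. Qed.

Lemma nowhere_dense_meager (F : set (nat -> bool)) : nowhere_dense F -> meager F.
Proof. by move=> ndF; exists (fun=> F) => // z Fz; exists 0. Qed.

Lemma meager0 : meager set0.
Proof. by apply: nowhere_dense_meager => z n; exists z, n; split=> // v _ []. Qed.

Lemma meager_bigcup (M : nat -> set (nat -> bool)) :
  (forall i, meager (M i)) -> meager (\bigcup_i M i).
Proof.
move=> mM; have /choice[F hF] : forall i, exists F : nat -> set (nat -> bool),
    (forall j, nowhere_dense (F j)) /\ M i `<=` \bigcup_j F j.
  by move=> i; have [F] := mM i; exists F.
exists (fun k => if unpickle k is Some (i, j) then F i j else set0).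
  move=> k; case: (unpickle k) => [[i j]|] /=; first exact: (hF i).1.
  by move=> z n; exists z, n; split=> // v _ [].
move=> z [i _ /(hF i).2[j _ Fz]]; exists (pickle (i, j)) => //.
by rewrite pickleK.
Qed.

Lemma meagerU (M M' : set (nat -> bool)) : meager M -> meager M' -> meager (M `|` M').
Proof.
move=> mM mM'; apply: (@sub_meager _ (\bigcup_i if i is 0 then M else M')).
  by move=> z [] Mz; [exists 0|exists 1].
by apply: meager_bigcup => -[].
Qed.

Lemma baire_category (M : set (nat -> bool)) : meager M ->
  forall z n, exists2 z', agree n z z' & ~ M z'.
Proof.
move=> [F ndF MF] z n.
have /choice[G hG] : forall q : nat * ((nat -> bool) * nat), exists p : (nat -> bool) * nat,
    [/\ q.2.2 < p.2, agree q.2.2 q.2.1 p.1 & forall v, agree p.2 p.1 v -> ~ F q.1 v].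
  move=> [i [a k]] /=; have [a' [m [km aa' h]]] := ndF i a k.
  exists (a', m.+1); split=> //= v av; apply: h; exact: agree_le av.
pose s := fix s i := if i is j.+1 then G (j, s j) else (z, n).
have sS i j : i <= j -> (s i).2 + (j - i) <= (s j).2 /\ agree (s i).2 (s i).1 (s j).1.
  move=> /subnKC <-; rewrite addKn; elim: (j - i) => [|k [IH1 IH2]].
    by rewrite !addn0; split.
  rewrite !addnS /=; have [h1 h2 _] := hG (i + k, s (i + k)).
  split; first exact: leq_ltn_trans h1.
  apply: agree_trans IH2 (agree_le _ h2).
  by apply: leq_trans IH1; apply: leq_addr.
have s_ge i : i <= (s i).2.
  by have [h _] := sS 0 i (leq0n i); apply: leq_trans h; rewrite subn0 leq_addl.
pose a i := (s i.+1).1 i.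
have sa i : agree (s i).2 (s i).1 a.
  move=> j ltj; rewrite /a; case: (leqP i j.+1) => [ij|/ltnW ji].
    by have [_ h] := sS i j.+1 ij; apply: h.
  by have [_ h] := sS j.+1 i ji; symmetry; apply: h; apply: s_ge.
exists a; first exact: (sa 0).
move=> /MF[i _ Fa]; have [_ _ h] := hG (i, s i).
by apply: (h a) => //; apply: (sa i.+1).
Qed.

Definition cylinder (z : nat -> bool) (n : nat) : set (nat -> bool) := [set v | agree n z v].

(** Equivalent to being open modulo a meager set, but visibly closed under
    complements. *)
Definition baire_property (Q : set (nat -> bool)) : Prop :=
  forall z n, exists z' m, [/\ n <= m, agree n z z' &
    meager (cylinder z' m `&` Q) \/ meager (cylinder z' m `\` Q)].

(** On the union of the cylinders where [Q] is meager, [Q] is meager because there are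
    countably many cylinders; by density the rest of the given cylinder is nowhere
    dense. *)
Lemma meager_cylinder_cover (Q : set (nat -> bool)) z n :
  (forall z' m, n <= m -> agree n z z' -> exists z'' k,
    [/\ m <= k, agree m z' z'' & meager (cylinder z'' k `&` Q)]) ->
  meager (cylinder z n `&` Q).
Proof.
move=> dense_meager.
pose C (s : seq bool) : set (nat -> bool) := cylinder (nth false s) (size s).
pose W i := if unpickle i is Some s then
    if `[< meager (C s `&` Q) >] then C s else set0 else set0.
apply: (@sub_meager _ ((cylinder z n `\` \bigcup_i W i) `|` \bigcup_i (W i `&` Q))).
  move=> v [zv Qv]; have [[i _ Wv]|nW] := pselect ((\bigcup_i W i) v).
    by right; exists i.
  by left.
apply: meagerU; last first.
  apply: meager_bigcup => i; rewrite /W; case: unpickle => [s|].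
    by case: asboolP => // _; rewrite set0I; exact: meager0.
  by rewrite set0I; exact: meager0.
apply: nowhere_dense_meager => a k; pose m := maxn n k.
have [za|nza] := pselect (agree n z a); last first.
  exists a, m; split=> [|//|v av [zv _]]; first exact: leq_maxr.
  apply: nza; apply: agree_trans zv (agree_sym _); apply: agree_le av.
  exact: leq_maxl.
have [a' [k' [mk aa' mea]]] := dense_meager a m (leq_maxl _ _) za.
exists a', k'; split.
- by apply: leq_trans mk; exact: leq_maxr.
- by apply: agree_le aa'; exact: leq_maxr.
move=> v a'v [_]; apply; pose s := prefix_of a' k'.
have sC : C s = cylinder a' k'.
  have nthE i : i < k' -> nth false s i = a' i by move=> ik; rewrite nth_mkseq.
  by rewrite /C /cylinder size_prefix; apply/seteqP; split=> u h i ik; rewrite -h // nthE.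
by exists (pickle s) => //; rewrite /W pickleK; case: asboolP; rewrite sC.
Qed.

Lemma baire_property_sigma : sigma_algebra setT [set Q | baire_property Q].
Proof.
split=> /= [z n|Q bQ z n|Q bQ z n].
- by exists z, n; split=> //; left; rewrite setI0; exact: meager0.
- have [z' [m [nm zz' h]]] := bQ z n; exists z', m; split=> //.
  by case: h => h; [right; rewrite setTD setDE setCK|left; rewrite setTD -setDE].
have [[j [z' [m [nm zz' h]]]]|no] := pselect (exists j z' m,
    [/\ n <= m, agree n z z' & meager (cylinder z' m `\` Q j)]).
  exists z', m; split=> //; right; apply: sub_meager h => v [zv nQ]; split=> // Qv.
  by apply: nQ; exists j.
exists z, n; split=> //; left; rewrite setI_bigcupr; apply: meager_bigcup => j.
apply: meager_cylinder_cover => z' m nm zz'.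
have [z'' [k [mk z'z'' []]]] := bQ j z' m; first by exists z'', k.
move=> h; case: no; exists j, z'', k; split=> //; first exact: leq_trans mk.
by apply: agree_trans zz' _; apply: agree_le z'z''.
Qed.

Lemma baire_property_locally_constant (P : (nat -> bool) -> Prop) :
  (forall z, exists n, forall v, agree n z v -> (P z <-> P v)) ->
  baire_property [set z | P z].
Proof.
move=> lc z n; have [k hk] := lc z; exists z, (maxn n k); split=> //.
  exact: leq_maxl.
have [Pz|nPz] := pselect (P z); [right|left]; apply: sub_meager meager0 => v [].
  by move=> zv; apply; apply/(hk v) => //; apply: agree_le zv; exact: leq_maxr.
by move=> zv Pv; apply: nPz; apply/(hk v) => //; apply: agree_le zv; exact: leq_maxr.
Qed.

Definition flip (n : nat) (z : nat -> bool) : nat -> bool :=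
  fun i => if i == n then ~~ z i else z i.

Lemma flipK n : involutive (flip n).
Proof. by move=> z; apply/funext => i; rewrite /flip; case: eqP => // _; rewrite negbK. Qed.

Lemma agree_flip n m z v : agree m z v -> agree m (flip n z) (flip n v).
Proof. by move=> zv i im; rewrite /flip zv. Qed.

Lemma meager_flip n (M : set (nat -> bool)) : meager M -> meager [set z | M (flip n z)].
Proof.
move=> [F ndF MF]; exists (fun i => [set z | F i (flip n z)]); last first.
  by move=> z /MF[i _ Fz]; exists i.
move=> i z k; have [z' [m [km zz' h]]] := ndF i (flip n z) k.
exists (flip n z'), m; split=> //.
  by rewrite -[z](flipK n); apply: agree_flip.
by move=> v zv; apply: h; rewrite -[z'](flipK n); apply: agree_flip.
Qed.

(** Flipping a bit beyond a cylinder on which [Q] is meager or comeager maps the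
    cylinder to itself and preserves category. *)
Lemma no_flip_alternating (Q : set (nat -> bool)) : baire_property Q ->
  ~ forall z n, Q (flip n z) <-> ~ Q z.
Proof.
move=> bQ alt; have [z [m [_ _ h]]] := bQ (fun=> false) 0.
have flipc v : cylinder z m v -> cylinder z m (flip m v).
  by move=> zv i im; rewrite /flip ltn_eqF //; apply: zv.
case: h => mM; have [v zv nM] := baire_category (meagerU mM (meager_flip m mM)) z m.
  have nQ : ~ Q v by move=> Qv; apply: nM; left.
  by apply: nM; right; split; [apply: flipc|apply/alt].
have Qv : Q v by apply: contrapT => nQv; apply: nM; left.
by apply: nM; right; split; [apply: flipc|move=> /alt].
Qed.

(** * Reparametrising a non-constant family of reals *)

(** A map [b] that is continuous and not constant on any cylinder becomes injective on
    a perfect subtree.  The subtree is taken such that at each level the two extensions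
    [t] and [t'] are the same for all nodes and have equal length, so that eventually
    equal branches remain eventually equal. *)
Section Reparametrisation.
Variable b : (nat -> bool) -> nat -> nat.
Hypothesis b_cont : forall z m, exists n, forall v, agree n z v -> b z m = b v m.
Hypothesis b_nonconst : forall z n, exists v v',
  [/\ agree n z v, agree n z v' & exists m, b v m <> b v' m].

Definition starts (s : seq bool) (z : nat -> bool) : Prop := agree (size s) (nth false s) z.

Lemma starts_cat s t z : starts (s ++ t) z -> starts s z.
Proof.
move=> h i si; rewrite -h ?size_cat ?ltn_addr //.
by rewrite nth_cat si.
Qed.

Definition distinguished (s s' : seq bool) : Prop := exists m v,
  (forall z, starts s z -> b z m <> v) /\ (forall z, starts s' z -> b z m = v).

Lemma distinguished_cat s s' t t' :
  distinguished s s' -> distinguished (s ++ t) (s' ++ t').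
Proof.
by move=> [m [v [h h']]]; exists m, v; split=> z /starts_cat; [apply: h|apply: h'].
Qed.

(** Extend [s'] arbitrarily to a point [u].  Since [b] is not constant above [s], one of
    two points above [s] has a value distinct from that of [u]. *)
Lemma distinguish2 s s' : exists t t',
  size t = size t' /\ distinguished (s ++ t) (s' ++ t').
Proof.
have [v [v' [sv sv' [m bvv']]]] := b_nonconst (nth false s) (size s).
pose u := prepend s' (fun=> false).
have su : starts s' u by move=> i si; rewrite /u /prepend si.
have [a sa bau] : exists2 a, starts s a & b a m <> b u m.
  have [e|] := pselect (b v m = b u m); last by exists v.
  by exists v' => //; rewrite -e; apply: nesym.
have [n hn] := b_cont a m; have [k hk] := b_cont u m.
have ext r z (j : nat) : starts r z -> r ++ prefix_of (fun i => z (size r + i)) j =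
    prefix_of z (size r + j).
  move=> rz; rewrite prefix_of_add; congr (_ ++ _).
  apply: (@eq_from_nth _ false) => [|i ri]; first by rewrite size_prefix.
  by rewrite nth_mkseq // rz.
exists (prefix_of (fun i => a (size s + i)) (maxn n k)),
       (prefix_of (fun i => u (size s' + i)) (maxn n k)).
rewrite !size_prefix !ext //; split=> //; exists m, (b u m); split=> z hz.
  have az : agree (size s + maxn n k) a z.
    by move=> i ik; rewrite -hz ?size_prefix // nth_mkseq.
  rewrite -(hn z) //; apply: agree_le az.
  by rewrite (leq_trans (leq_maxl n k)) ?leq_addl.
have uz : agree (size s' + maxn n k) u z.
  by move=> i ik; rewrite -hz ?size_prefix // nth_mkseq.
rewrite -(hk z) //; apply: agree_le uz.
by rewrite (leq_trans (leq_maxr n k)) ?leq_addl.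
Qed.

Lemma distinguish_all (l : seq (seq bool)) : exists t t',
  size t = size t' /\ forall s, s \in l -> distinguished (s ++ t) (s ++ t').
Proof.
elim: l => [|s l [t [t' [szt h]]]]; first by exists [::], [::].
have [r [r' [szr hr]]] := distinguish2 (s ++ t) (s ++ t').
exists (t ++ r), (t' ++ r'); rewrite !size_cat szt szr; split=> // s0.
rewrite inE => /predU1P[->|/h]; rewrite !catA //.
exact: distinguished_cat.
Qed.

Definition pick_block (e : bool) (T : seq bool * seq bool) := if e then T.2 else T.1.

Fixpoint blocks (T : nat -> seq bool * seq bool) (k : nat) (s : seq bool) : seq bool :=
  if s is e :: s' then pick_block e (T k) ++ blocks T k.+1 s' else [::].

Lemma blocks_cat T k s s' : blocks T k (s ++ s') = blocks T k s ++ blocks T (k + size s) s'.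
Proof.
elim: s k => [|e s IH] k /=; first by rewrite addn0.
by rewrite IH catA addnS.
Qed.

(** Recovers the sequence [z] from [b] at the image of [z]: if the bits found so far are [s],
    the next bit tells whether the value at [pos s] is [target s]. *)
Definition decode (pos target : seq bool -> nat) (a : nat -> nat) : nat -> seq bool :=
  fix rec n := if n is m.+1 then rcons (rec m) (a (pos (rec m)) == target (rec m)) else [::].

Theorem reparametrisation : exists (h : (nat -> bool) -> nat -> bool) (pos target : seq bool -> nat),
  [/\ forall n z z', agree n z z' -> agree n (h z) (h z'),
      forall z n, exists N, forall j, N <= j -> h (flip n z) j = h z j
    & forall z n, decode pos target (b (h z)) n = prefix_of z n].
Proof.
have /choice[next hnext] : forall l : seq (seq bool), exists T : seq bool * seq bool,
    size T.1 = size T.2 /\ forall s, s \in l -> distinguished (s ++ T.1) (s ++ T.2).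
  by move=> l; have [t [t' h]] := distinguish_all l; exists (t, t').
pose l_ := fix l_ n := if n is m.+1 then
  map (cat^~ (next (l_ m)).1) (l_ m) ++ map (cat^~ (next (l_ m)).2) (l_ m) else [:: [::]].
pose T n := next (l_ n).
have szT n e : size (pick_block e (T n)) = size (T n).1.
  by have [sz _] := hnext (l_ n); case: e.
have blocks_in s : blocks T 0 s \in l_ (size s).
  elim/last_ind: s => // s e IH.
  rewrite -cats1 blocks_cat add0n size_cat addn1 /= cats0 mem_cat; case: e;
    by rewrite (map_f (cat^~ _) IH) ?orbT.
have dist s : distinguished (blocks T 0 (rcons s false)) (blocks T 0 (rcons s true)).
  rewrite -!cats1 !blocks_cat add0n /= !cats0.
  by have [_ h] := hnext (l_ (size s)); apply: h.
(* A node is not distinguished from itself, so the extensions are not empty. *)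
have T_gt0 n : 0 < size (T n).1.
  rewrite lt0n; apply/eqP => sz0; have := dist (nseq n false).
  rewrite -!cats1 !blocks_cat add0n /= size_nseq !cats0.
  have -> : (T n).1 = [::] by apply: size0nil.
  have -> : (T n).2 = [::] by apply: size0nil; apply: etrans (szT n true) sz0.
  move=> [m [v []]]; set s := _ ++ _; pose z := prepend s (fun=> false).
  have sz : starts s z by move=> i si; rewrite /z /prepend si.
  by move=> /(_ z sz) ne /(_ z sz).
have sz_blocks k s s' : size s = size s' -> size (blocks T k s) = size (blocks T k s').
  elim: s s' k => [|e s IH] [|e' s'] //= k [ss']; rewrite !size_cat !szT.
  by rewrite (IH s').
have blocks_ge k s : size s <= size (blocks T k s).
  elim: s k => //= e s IH k; rewrite size_cat szT -add1n.
  by apply: leq_add.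
pose h z j := nth false (blocks T 0 (prefix_of z j.+1)) j.
have h_starts z n : starts (blocks T 0 (prefix_of z n)) (h z).
  move=> j jn; rewrite /h.
  case: (leqP n j.+1) => [/subnKC <-|/ltnW/subnKC nE].
    by rewrite prefix_of_add blocks_cat nth_cat jn.
  rewrite -nE prefix_of_add blocks_cat nth_cat ifT //.
  by apply: leq_trans (blocks_ge _ _); rewrite size_prefix.
have [mv hmv] := choice (fun s => dist s).
have /choice[target hvv] : forall s, exists v,
  (forall z, starts (blocks T 0 (rcons s false)) z -> b z (mv s) <> v) /\
  (forall z, starts (blocks T 0 (rcons s true)) z -> b z (mv s) = v) by exact: hmv.
exists h, mv, target; split.
- move=> n z z' zz' j jn; rewrite /h; congr (nth _ (blocks _ _ _) _).
  exact: prefix_of_agree zz'.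
- move=> z n; exists (size (blocks T 0 (prefix_of z n.+1))) => j jN.
  have nj : n < j.+1.
    by rewrite ltnS; apply: leq_trans jN; apply: leq_trans (blocks_ge _ _); rewrite size_prefix.
  rewrite /h -(subnKC nj) !prefix_of_add !blocks_cat !size_prefix.
  have szE : size (blocks T 0 (prefix_of (flip n z) n.+1)) = size (blocks T 0 (prefix_of z n.+1)).
    by apply: sz_blocks; rewrite !size_prefix.
  have tailE : (fun i => flip n z (n.+1 + i)) = (fun i => z (n.+1 + i)).
    by apply/funext => i; rewrite /flip addSn eq_sym ltn_eqF // ltnS leq_addr.
  by rewrite !nth_cat szE ltnNge jN tailE.
- move=> z; elim=> //= n ->.
  have -> : prefix_of z n.+1 = rcons (prefix_of z n) (z n).
    by rewrite -addn1 prefix_of_add -cats1 /= /prefix_of /mkseq /= addn0.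
  congr rcons; set s := prefix_of z n; have [h0 h1] := hvv s.
  have hs := h_starts z n.+1; move: hs.
  have -> : prefix_of z n.+1 = rcons s (z n).
    by rewrite -addn1 prefix_of_add -cats1 /= /prefix_of /mkseq /= addn0.
  by case: (z n) => hs; [apply/eqP/h1|apply/eqP/h0].
Qed.

End Reparametrisation.

(** * Invariant sections *)

Section Sections.
Variables (X : Type) (SX : set (set X)) (E : X -> X -> Prop).
Hypotheses (sX : sigma_algebra setT SX) (hE : countable_borel_equivalence SX E).

Definition invariant_section (g : X -> set nat) : Prop :=
  (forall k, SX [set x | g x k]) /\ forall x y, E x y -> g x = g y.

(** The sections are filtered at each point by the property of producing a member of
    the family.  Since this property and the sections depend only on the class, so does
    the sequence of sets obtained, and then the diagonal sequence [m x] is the same for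
    all points of the class. *)
Lemma pseudointersection_of_sections (phi : X -> nat -> infset) (D : set (X -> set nat)) :
  hom_to_seq_infset SX E phi -> (forall x, centered (range (phi x))) ->
  countable D -> D `<=` invariant_section ->
  (forall x n, exists2 g, D g & iset (phi x n) = g x) ->
  exists2 psi, hom_to_infset SX E psi & forall x n, sub_star (psi x) (phi x n).
Proof.
move=> [/(borel_map_seq_infsetP sX) bphi Ephi] cphi cD Dsec cover.
have symE := @cber_sym _ _ _ hE.
have [s hs Ds] : exists2 s : nat -> X -> set nat, forall j, invariant_section (s j) &
    forall g, D g -> exists j, s j = g.
  have /countable_injP[i inj_i] := cD.
  have /choice[s hs] : forall j, exists g, invariant_section g /\
      ((exists2 g', D g' & i g' = j) -> D g /\ i g = j).
    move=> j; have [[g Dg ig]|no] := pselect (exists2 g, D g & i g = j).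
      by exists g; split=> //; apply: Dsec.
    exists (fun _ => setT); split; last by move=> h; case: no.
    by split=> // k; apply: (borel_const sX True).
  exists s => [j|g Dg]; first exact: (hs j).1.
  exists (i g); have [_ [|Ds is_]] := hs (i g); first by exists g.
  by apply: inj_i => //; apply: mem_set.
pose J x j := exists i, iset (phi x i) = s j x.
(* [R x n] is the tail from [n] of the intersection of the first sets of the sequence. *)
pose R x n k := n <= k /\ forall j, j <= n -> J x j -> s j x k.
have bJ j : SX [set x | J x j].
  apply: (borel_ex sX) => i.
  apply: (borel_ext (SX := SX) (P := fun x => forall k, iset (phi x i) k <-> s j x k)).
    by move=> x; split=> [h|-> //]; apply/seteqP; split=> k /h.
  by apply: (borel_all sX) => k; apply: (borel_iff sX); [apply: bphi|apply: (hs j).1].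
have bR n k : SX [set x | R x n k].
  apply: (borel_and sX); first exact: (borel_const sX).
  apply: (borel_all sX) => j; apply: (borel_imp sX); first exact: (borel_const sX).
  by apply: (borel_imp sX) => //; apply: (hs j).1.
have exR x n : exists k, R x n k.
  have /choice[g hg] : forall j, exists i, J x j -> iset (phi x i) = s j x.
    move=> j; have [[i ij]|nJ] := pselect (J x j); first by exists i.
    by exists 0.
  have /centeredP/(_ (map g (iota 0 n.+1)))/infinite_natP/(_ n)[k nk hk] := cphi x.
  exists k; split=> // j jn Jj; rewrite -(hg j Jj); apply: hk; apply: map_f.
  by rewrite mem_iota add0n ltnS.
pose m x n := least (R x n).
have mR x n : R x n (m x n) := (leastP (exR x n)).1.
pose P x : set nat := [set k | exists n, m x n = k].
have PE x : iset (to_infset (P x)) = P x.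
  apply/to_infsetE/infinite_natP => N; exists (m x N); last by exists N.
  by have [] := mR x N.
have JE x y j : E x y -> J x j <-> J y j.
  move=> xy; have sE := (hs j).2 x y xy.
  split=> -[i].
    by have [g hg] := Eset_index (Ephi _ _ xy); rewrite sE hg; exists (g i).
  have [g hg] := Eset_index (Ephi _ _ (symE _ _ xy)).
  by rewrite -sE hg; exists (g i).
have mE x y : E x y -> m x = m y.
  move=> xy; apply/funext => n; apply: eq_least => k; rewrite /R.
  by split=> -[nk h]; split=> // j jn /(JE _ _ _ xy) Jj; have := h j jn Jj;
     rewrite ((hs j).2 x y xy).
exists (fun x => to_infset (P x)); first split.
- apply/(borel_map_infsetP sX); apply: (borel_to_infset sX) => k.
  by apply: (borel_ex sX) => n; apply: (borel_least sX).
- move=> x y /mE xy; apply/E0_infsetP; exists 0 => k _.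
  by rewrite !PE /P /= xy.
move=> x n; rewrite PE; apply/sub_starP.
have [g Dg phig] := cover x n; have [j sj] := Ds g Dg.
have Jj : J x j by exists n; rewrite sj.
exists (\max_(i < j) m x i).+1 => k kbig [i mi]; rewrite phig -sj -mi.
have [_] := mR x i; apply=> //; rewrite leqNgt; apply/negP => ij.
have := leq_bigmax (F := fun i : 'I_j => m x i) (Ordinal ij).
by rewrite /= mi leqNgt kbig.
Qed.

End Sections.

(** * The splitting property produces pseudointersections *)

Definition indicator (A : set nat) : nat -> nat := fun m => `[< A m >].

Lemma indicator_inj A B : indicator A = indicator B -> A = B.
Proof.
move=> AB; apply/seteqP; split=> k; have := congr1 (fun g => g k) AB;
  by rewrite /indicator; do 2!case: asboolP.
Qed.

Lemma borel_decode (X : Type) (SX : set (set X)) (A : X -> infset) pos target n s :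
  sigma_algebra setT SX -> (forall k, SX [set x | iset (A x) k]) ->
  SX [set x | decode pos target (indicator (A x)) n = s].
Proof.
move=> sX bA; elim: n s => [|n IH] s /=; first exact: (borel_const sX).
pose step (e : nat) s' := rcons s' (e == target s').
apply: (borel_ext (SX := SX) (P := fun x => exists s', decode pos target (indicator (A x)) n = s' /\
  ((iset (A x) (pos s') -> step 1 s' = s) /\ (~ iset (A x) (pos s') -> step 0 s' = s)))).
  move=> x; split=> [[s' [-> [h1 h0]]]|h].
    by rewrite /indicator; case: asboolP => [/h1|/h0].
  exists (decode pos target (indicator (A x)) n); split=> //; rewrite -h /step /indicator.
  by split=> hA; case: asboolP.
apply: (borel_exC sX) => s'; apply: (borel_and sX) => //.
apply: (borel_and sX); apply: (borel_imp sX); try exact: (borel_const sX).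
  exact: bA.
exact: (borel_not sX).
Qed.

(** The parity of the number of ones in the sequence [s k] is recorded by which of the
    numbers [2k] and [2k+1] belongs to the set.  The set and its complement are thus both
    infinite, whatever the parities are. *)
Definition parity_set (s : nat -> seq bool) : set nat :=
  [set m | odd m = odd (count id (s m./2))].

Lemma infinite_parity_set s : infinite_set (parity_set s).
Proof.
apply/infinite_natP => N; exists (odd (count id (s N)) + N.*2).
  by rewrite -addnn addnCA leq_addr.
by rewrite /parity_set /= half_bit_double oddD odd_double addbF oddb.
Qed.

Lemma parity_set_flip n z m : n.+1.*2 <= m ->
  parity_set (prefix_of (flip n z)) m <-> ~ parity_set (prefix_of z) m.
Proof.
move=> nm; rewrite /parity_set /=.
have nk : n < m./2 by rewrite geq_half_double.
have split_prefix y : prefix_of y m./2 = prefix_of y n ++ y n ::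
    prefix_of (fun i => y (n.+1 + i)) (m./2 - n.+1).
  rewrite -{1}(subnKC nk) prefix_of_add -addn1 prefix_of_add -catA.
  by rewrite [prefix_of _ 1]/= /prefix_of /mkseq /= addn0.
rewrite !split_prefix !count_cat /=.
have -> : prefix_of (flip n z) n = prefix_of z n.
  by apply: (@prefix_of_agree _ n) => // i ltin; rewrite /flip ltn_eqF.
have -> : (fun i => flip n z (n.+1 + i)) = (fun i => z (n.+1 + i)).
  by apply/funext => i; rewrite /flip addSn eq_sym ltn_eqF // ltnS leq_addr.
rewrite {1}/flip eqxx !oddD !oddb.
move: (odd _) (odd _) (odd _) (z n) => [] [] [] []; split=> //= h; by case: h.
Qed.

Section Splitting.
Variables (X : Type) (SX : set (set X)) (E : X -> X -> Prop) (f : (nat -> nat) -> X).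
Hypotheses (sX : sigma_algebra setT SX) (hE : countable_borel_equivalence SX E).
Hypothesis hf : suslin_param SX f.
Variable phi : X -> nat -> infset.
Hypothesis hphi : hom_to_seq_infset SX E phi.

Let bphi : forall n k, SX [set x | iset (phi x n) k].
Proof. by case: hphi => /(borel_map_seq_infsetP sX). Qed.

(** Component [0] codes a point of [X], the first value of component [1] is an index of
    a member of the family at that point, and component [2] is its indicator. *)
Definition labelled (v : nat -> nat) : Prop :=
  component 2 v = indicator (phi (f (component 0 v)) (component 1 v 0)).

Lemma suslin_labelled : suslin labelled.
Proof.
apply: (suslin_borel (B := [set v | labelled v])).
have bc j : forall i m, baire_borel [set v | component j v i = m].
  exact: ((borel_map_baireP baire_sigma (component j)).1 (borel_continuousN (continuous_proj j))).
apply: (borel_ext (SX := baire_borel) (P := fun v => exists n, component 1 v 0 = n /\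
  forall m, (component 2 v m = 1 /\ iset (phi (f (component 0 v)) n) m) \/
            (component 2 v m = 0 /\ ~ iset (phi (f (component 0 v)) n) m))).
  move=> v; rewrite /labelled /indicator; split=> [[_ [<- h]]|h].
    by apply/funext => m; case: (h m) => -[->]; case: asboolP.
  exists (component 1 v 0); split=> // m; have -> := congr1 (fun g => g m) h.
  by case: asboolP => ?; [left|right].
have bf n m : baire_borel [set v | iset (phi (f (component 0 v)) n) m].
  exact: (borel_continuousN (continuous_proj 0)) _ (sp_borel hf (bphi n m)).
apply: (borel_ex baire_sigma) => n; apply: (borel_and baire_sigma) => //.
apply: (borel_all baire_sigma) => m; apply: (borel_or baire_sigma);
  apply: (borel_and baire_sigma) => //.
exact: (borel_not baire_sigma).
Qed.

(** Vertices are pairs of a labelled code and a witness that it is labelled. *)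
Definition point (w : nat -> nat) : nat -> nat := component 0 (component 0 w).

(** The coordinate of a vertex that holds the [m]-th value of its label. *)
Definition label_index (m : nat) : nat := pickle (0, pickle (2, m)).

(** The edges connect any two eventually equal sequences, so [point] sends them to
    [E]-related points.  On the reparametrised family the label determines the sequence, and
    the splitting property is applied to the parity sets of the decoded members. *)
Lemma splitting_no_embedding (V : (nat -> bool) -> nat -> nat) (node : nat -> seq bool) :
  prop_s SX E ->
  (forall n, size (node n) = n) ->
  (forall z m, exists2 n, m <= n & agree m z (nth false (node n))) ->
  (forall n z z', agree n z z' -> agree n (V z) (V z')) ->
  (forall z, exists n, forall m, V z (label_index m) = indicator (phi (f (point (V z))) n) m) ->
  (forall k w, E (f (point (V (prepend (rcons (node k) false) w))))
                 (f (point (V (prepend (rcons (node k) true) w))))) ->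
  (forall k w, exists m, V (prepend (rcons (node k) false) w) (label_index m) <>
                         V (prepend (rcons (node k) true) w) (label_index m)) ->
  False.
Proof.
move=> hs size_node dense_node V_cont V_label V_edge V_diff.
have symE := @cber_sym _ _ _ hE.
pose b z m := V z (label_index m).
have b_cont z m : exists n, forall v, agree n z v -> b z m = b v m.
  by exists (label_index m).+1 => v /V_cont; apply.
have b_nonconst z n : exists v v',
    [/\ agree n z v, agree n z v' & exists m, b v m <> b v' m].
  have [k nk zk] := dense_node z n.
  exists (prepend (rcons (node k) false) z), (prepend (rcons (node k) true) z).
  have ag e : agree n z (prepend (rcons (node k) e) z).
    move=> i ltin; rewrite zk // /prepend size_rcons size_node.
    have ik : i < k by apply: leq_trans nk.
    by rewrite ltnS (ltnW ik) nth_rcons size_node ik.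
  by split=> //; apply: V_diff.
(* To pass from [z] to [z'] when they differ at [N]: move to [node N] below [N], cross the
   edge there, and move back. *)
have tailE N z z' : (forall j, N <= j -> z j = z' j) -> E (f (point (V z))) (f (point (V z'))).
  elim: N z z' => [|N IH] z z' zz'.
    by rewrite (_ : z = z'); [apply: (cber_refl hE)|apply/funext => j; apply: zz'].
  have [eN|neN] := eqVneq (z N) (z' N).
    by apply: IH => j; rewrite leq_eqVlt => /predU1P[<-//|]; apply: zz'.
  pose w i := z (N.+1 + i); pose y e := prepend (rcons (node N) e) w.
  have yE e v : v N = e -> (forall j, N < j -> z j = v j) -> forall j, N <= j -> v j = y e j.
    move=> vN zv j; rewrite /y /prepend size_rcons size_node leq_eqVlt.
    move=> /predU1P[<-|Nj]; first by rewrite ltnSn nth_rcons size_node ltnn eqxx.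
    by rewrite ltnS leqNgt Nj /= /w subnKC // zv.
  have yy : E (f (point (V (y (z N))))) (f (point (V (y (z' N))))).
    move: neN; case: (z N); case: (z' N) => // _; last exact: V_edge.
    by apply: symE; apply: V_edge.
  apply: (cber_trans hE) (IH z (y (z N)) _) _; first exact: yE.
  apply: (cber_trans hE) yy (symE _ _ _); apply: IH.
  exact: (yE _ z' erefl zz').
have [h [pos [target [h_cont h_flip h_decode]]]] := reparametrisation b_cont b_nonconst.
pose x z := f (point (V (h z))).
have x_flip n z : E (x z) (x (flip n z)).
  have [N hN] := h_flip z n; apply: (tailE N) => j Nj.
  by rewrite hN.
pose F (A : infset) := to_infset (parity_set (decode pos target (indicator A))).
have FE A : iset (F A) = parity_set (decode pos target (indicator A)).
  exact/to_infsetE/infinite_parity_set.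
have [|psi [/(borel_map_infsetP sX) bpsi Epsi] unsplit] := hs (fun x n => F (phi x n)).
  split; last by move=> y y' /(hphi.2); apply: (Eset_comp F).
  apply/(borel_map_seq_infsetP sX) => n; apply: (borel_to_infset sX) => m.
  apply: (borel_ext (SX := SX) (P := fun y => exists s,
      decode pos target (indicator (phi y n)) m./2 = s /\ odd m = odd (count id s))).
    by move=> y; split=> [[s [<- //]]|om]; exists (decode pos target (indicator (phi y n)) m./2).
  apply: (borel_exC sX) => s; apply: (borel_and sX); last exact: (borel_const sX).
  by apply: borel_decode.
have dich z : sub_star (psi (x z)) (parity_set (prefix_of z)) \/
              sub_star (psi (x z)) (~` parity_set (prefix_of z)).
  have [n hn] := V_label (h z); have := unsplit (x z) n.
  have -> : iset (F (phi (x z) n)) = parity_set (prefix_of z).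
    rewrite FE; congr parity_set; apply/funext => k; rewrite -h_decode.
    by congr (decode _ _ _ _); apply/funext => m; rewrite -hn.
  by [].
apply: (@no_flip_alternating [set z | sub_star (psi (x z)) (parity_set (prefix_of z))]).
  have sB := baire_property_sigma.
  have lc_borel : borel_map [set Q | baire_property Q] baire_borel (fun z => point (V (h z))).
    apply/(borel_map_baireP sB) => i m; apply: baire_property_locally_constant => z.
    have [n hn] := continuous_proj2 0 0 (V (h z)) i.
    by exists n => v /h_cont/V_cont/hn; rewrite /point => ->.
  have bx k : baire_property [set z | iset (psi (x z)) k].
    exact: lc_borel _ (sp_borel hf (bpsi k)).
  apply: (borel_ext (SX := [set Q | baire_property Q]) (P := fun z => exists N, forall k, N <= k ->
            iset (psi (x z)) k -> parity_set (prefix_of z) k)).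
    by move=> z; rewrite sub_starP.
  apply: (borel_ex sB) => N; apply: (borel_all sB) => k.
  apply: (borel_imp sB); first exact: (borel_const sB).
  apply: (borel_imp sB); first exact: bx.
  apply: baire_property_locally_constant => z; exists k => v zv.
  by rewrite /parity_set /= (prefix_of_agree _ zv) // -divn2 leq_div.
move=> z n /=.
have /E0_infsetP[N hN] := Epsi _ _ (x_flip n z).
have far M : exists2 k, M <= k & iset (psi (x z)) k.
  by have /infinite_natP := @isetP (psi (x z)); apply.
split=> [/sub_starP[M hM] /sub_starP[M' hM']|nQ].
  have [k] := far (maxn (maxn N M) (maxn M' n.+1.*2)).
  rewrite !geq_max => /andP[/andP[Nk Mk] /andP[M'k nk]] pk.
  have /(parity_set_flip z nk) := hM k Mk ((hN k Nk).1 pk).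
  by apply; apply: hM'.
have [//|/sub_starP[M hM]] := dich z.
apply/sub_starP; exists (maxn (maxn N M) n.+1.*2) => k.
rewrite !geq_max => /andP[/andP[Nk Mk] nk] pk; apply/parity_set_flip => //.
by apply: hM => //; apply/hN.
Qed.

(** Instance of the dichotomy in which the parameters are the sections and the edges are
    the witnesses that two points are [E]-related. *)
Lemma sections_or_embedding :
  (exists D : set (X -> set nat), [/\ countable D, D `<=` invariant_section SX E &
     forall x n, exists2 g, D g & iset (phi x n) = g x]) \/
  (forall node : nat -> seq bool, (forall n, size (node n) = n) ->
   exists V : (nat -> bool) -> nat -> nat,
   [/\ forall n z z', agree n z z' -> agree n (V z) (V z'),
     forall z, exists n, forall m, V z (label_index m) = indicator (phi (f (point (V z))) n) m,
     forall k w, E (f (point (V (prepend (rcons (node k) false) w))))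
                   (f (point (V (prepend (rcons (node k) true) w)))) &
     forall k w, exists m, V (prepend (rcons (node k) false) w) (label_index m) <>
                           V (prepend (rcons (node k) true) w) (label_index m)]).
Proof.
have [|nocover] := pselect (exists D : set (X -> set nat), [/\ countable D,
  D `<=` invariant_section SX E & forall x n, exists2 g, D g & iset (phi x n) = g x]); first by left.
right=> node size_node.
have [L cL LP] := suslin_labelled; have [L2 cL2 L2P] := suslin_equivalence hf hE.
pose vertex w := L (pairN (component 0 w) (component 1 w)).
pose edge v w e := L2 (pairN (pairN (point v) (point w)) e).
have c_point g : continuousN g -> continuousN (fun w => point (g w)).
  by move=> cg; do 2!apply: continuous_component.
have closed_vertex : closedN vertex.
  by apply: closedN_preimage => //; apply: continuous_pair; apply: continuous_proj.
have vertex_label w : vertex w -> forall m, w (label_index m) =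
    indicator (phi (f (point w)) (component 1 (component 0 w) 0)) m.
  move=> vw m; have /LP lw : exists u, L (pairN (component 0 w) u) by exists (component 1 w).
  exact: (congr1 (fun g => g m) lw).
have closedL2 g g' g'' : continuousN g -> continuousN g' -> continuousN g'' ->
    closedN (fun w => edge (g w) (g' w) (g'' w)).
  move=> cg cg' cg''; apply: closedN_preimage => //.
  by apply: continuous_pair => //; apply: continuous_pair; apply: c_point.
have closed_edge v w e : (forall n, exists v' w' e',
    [/\ agree n v v', agree n w w', agree n e e' & edge v' w' e']) -> edge v w e.
  pose J v w e := join (fun j => match j with 0 => v | 1 => w | _ => e end).
  have := closedL2 _ _ _ (continuous_proj 0) (continuous_proj 1) (continuous_proj 2).
  move=> /(_ (J v w e)); rewrite /J !component_join => cl approx; apply: cl => n.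
  have [m hm] := join_agree n; have [v' [w' [e' [vv' ww' ee' h]]]] := approx m.
  exists (J v' w' e'); rewrite /J !component_join; split=> //.
  by apply: hm => -[|[|]].
pose Sec := {g : X -> set nat | invariant_section SX E g}.
pose kill (t : Sec) w := forall m, w (label_index m) = indicator (sval t (f (point w))) m.
have borel_kill t : baire_borel [set w | kill t w].
  apply: (borel_all baire_sigma) => m.
  have bw k : baire_borel [set w | w (label_index m) = k].
    have := borel_continuousN continuous_id.
    by move/(borel_map_baireP baire_sigma); apply.
  have bt : baire_borel [set w | sval t (f (point w)) m].
    have [bg _] := svalP t.
    exact: (borel_continuousN (c_point _ continuous_id)) _ (sp_borel hf (bg m)).
  apply: (borel_ext (SX := baire_borel) (P := fun w =>
      (w (label_index m) = 1 /\ sval t (f (point w)) m) \/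
      (w (label_index m) = 0 /\ ~ sval t (f (point w)) m))).
    move=> w; rewrite /indicator; split=> [[] [->]|->]; [by case: asboolP|by case: asboolP|].
    by case: asboolP => ?; [left|right].
  apply: (borel_or baire_sigma); apply: (borel_and baire_sigma) => //.
  exact: (borel_not baire_sigma).
have [||V [V1 V2 V3 V4]] := @dichotomy_embedding vertex edge label_index closed_vertex
    closed_edge Sec kill node size_node.
(* By assumption no countable family of sections accounts for all the labels. *)
- move=> D cD; have [x [n xn]] : exists x n, forall t, D t -> iset (phi x n) <> sval t x.
    apply: contrapT => no; apply: nocover; exists [set sval t | t in D]; split.
    + exact: sub_countable (card_image_le _ _) cD.
    + by move=> _ [t _ <-]; apply: (svalP t).
    + move=> x n; apply: contrapT => no'; apply: no; exists x, n => t Dt e.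
      by apply: no'; exists (sval t) => //; exists t.
  have [a ax] := sp_surj hf x.
  pose v := join (fun j => match j with 0 => a | 1 => fun=> n | _ => indicator (phi x n) end).
  have lv : labelled v by rewrite /labelled /v !component_join ax.
  have [u Lu] := (LP v).1 lv; exists (pairN v u).
    by rewrite /vertex component_pair0 component_pair1.
  move=> t Dt kt; apply: (xn t Dt); apply: indicator_inj; apply/funext => m.
  have := kt m; rewrite /point component_pair0 /v component_join ax => <-.
  transitivity (component 2 (component 0 (pairN v u)) m) => //.
  by rewrite component_pair0 /v component_join.
(* A family of labels constant on each class is a section: both the points with a label
   having [k] as an element and those with a label omitting it form Suslin sets, and
   the invariant separation of these for each [k] defines the section. *)
- move=> n p D cD indep.
  pose cfg (u : nat -> nat) : configuration := fun j => component (pickle j) u.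
  pose code (c : configuration) : nat -> nat :=
    join (fun k => if unpickle k is Some j then c j else fun=> 0).
  have codeK c : cfg (code c) = c.
    by apply/funext => j; rewrite /cfg component_join pickleK.
  have c_cfg j : continuousN (fun q => cfg (component 1 q) j) by apply: continuous_proj2.
  have s_adm : suslin (fun q => admissible vertex edge kill node n p D (cfg (component 1 q))).
    apply: (suslin_ext (P := fun q => proper vertex edge node n (cfg (component 1 q)) /\
      (satisfies p (cfg (component 1 q)) /\ avoids kill n D (cfg (component 1 q))))).
      by move=> q; split=> [[? []]|[]].
    apply: suslin_and; [apply: suslin_and|apply: suslin_and].
    + apply: (@suslin_allC (seq bool)) => s; apply: suslin_imp; apply: suslin_closed.
      exact: closedN_preimage.
    + apply: suslin_all => k; apply: (@suslin_allC (seq bool)) => s; apply: suslin_imp.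
      by apply: suslin_closed; apply: closedL2.
    + apply: (@suslin_allC (index * (nat * nat))%type) => q; apply: suslin_imp.
      by apply: suslin_closed; apply: (@closedN_coordinate (fun w => cfg (component 1 w) q.1) _ [set q.2.2]).
    + apply: (suslin_ext (P := fun q => forall s, size s = n -> forall t, D t ->
          ~ kill t (cfg (component 1 q) (None, s)))).
        by move=> q; split=> h s ? ? ?; apply: h.
      apply: (@suslin_allC (seq bool)) => s; apply: suslin_imp.
      apply: (suslin_preimage (P := fun w => forall t, D t -> ~ kill t w)) => //.
      apply: (suslin_borel (B := [set w | forall t, D t -> ~ kill t w])).
      apply: (borel_all_countable baire_sigma cD) => t _.
      exact: (borel_not baire_sigma).
  pose P (C : set nat) k w := exists c : configuration, [/\
    admissible vertex edge kill node n p D c, point (c (None, node n)) = w &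
    C (c (None, node n) (label_index k))].
  have sP C k : suslin (P C k).
    pose R q := admissible vertex edge kill node n p D (cfg (component 1 q)) /\
      ((forall i, point (cfg (component 1 q) (None, node n)) i = component 0 q i) /\
       C (cfg (component 1 q) (None, node n) (label_index k))).
    apply: (suslin_ext (P := fun w => exists u, R (pairN w u))).
      move=> w; split=> [[u]|[c [ac pc Cc]]].
        rewrite /R component_pair0 component_pair1 => -[a1 [a2 a3]].
        by exists (cfg u); split=> //; apply/funext.
      by exists (code c); rewrite /R component_pair0 component_pair1 codeK -pc.
    apply/suslin_exN/suslin_and => //; apply: suslin_and.
      apply: suslin_all => i; apply: (suslin_ext (P := fun q => forall m,
          component 0 q i = m -> point (cfg (component 1 q) (None, node n)) i = m)).
        by move=> q; split=> [h|-> //]; rewrite (h _ erefl).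
      apply: suslin_closed => q hq m qm.
      have [k1 h1] := continuous_proj 0 q i.
      have [k2 h2] := c_point _ (c_cfg (None, node n)) q i.
      have [q' [qq' h]] := hq (maxn k1 k2).
      rewrite (h2 q'); last by apply: agree_le qq'; exact: leq_maxr.
      apply: h; rewrite -qm; symmetry; apply: h1; apply: agree_le qq'; exact: leq_maxl.
    apply: suslin_closed.
    exact: (@closedN_coordinate (fun q => cfg (component 1 q) (None, node n)) _ C).
  have /choice[B hB] : forall k, exists B, [/\ SX B, forall x y, E x y -> B x -> B y,
      forall w, P [set 1] k w -> B (f w) & forall w, P (~` [set 1]) k w -> ~ B (f w)].
    move=> k; apply: (invariant_separation sX hf hE) => // w v.
    move=> [c [ac cw c1]] [c' [ac' cv c0]] wv.
    have /L2P[e Le] : E (f (component 0 (pairN w v))) (f (component 1 (pairN w v))).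
      by rewrite component_pair0 component_pair1.
    apply: c0; rewrite /= -(indep c c' e) //.
    by rewrite /edge cw cv.
  have secB : invariant_section SX E (fun x => [set k | B k x]).
    split=> [k|x y xy]; first by have [] := hB k.
    apply/seteqP; split=> k /=; have [_ h _ _] := hB k; apply: h => //.
    exact: (cber_sym hE).
  exists (exist _ _ secB) => c ac m.
  have [[vc _] _ _] := ac; have := vertex_label _ (vc _ (size_node n)) m.
  have [_ _ h1 h0] := hB m; rewrite /indicator /=.
  case: asboolP => _ cm; case: asboolP => // Bm.
    by case: Bm; apply: h1; exists c; split.
  by case: (h0 (point (c (None, node n)))) => //; exists c; split=> //=; rewrite cm.
exists V; split=> //.
- by move=> z; exists (component 1 (component 0 (V z)) 0); apply: vertex_label.
- move=> k w; have [e he] := V3 k w.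
  have /L2P : exists e, L2 (pairN (pairN (point (V (prepend (rcons (node k) false) w)))
                              (point (V (prepend (rcons (node k) true) w)))) e) by exists e.
  by rewrite component_pair0 component_pair1.
Qed.

End Splitting.

(** The sequence coded by [n], truncated or padded to length [n].  Pairing it with a
    dummy number makes it appear for arbitrarily large [n], hence without truncation. *)
Definition dense_node (n : nat) : seq bool :=
  prefix_of (nth false (odflt ([::], 0) (unpickle n : option (seq bool * nat))).1) n.

Lemma dense_nodeP z m : exists2 n, m <= n & agree m z (nth false (dense_node n)).
Proof.
have inj : injective (fun j : nat => pickle (prefix_of z m, j)).
  by move=> j j' e; have := pcan_inj (@pickleK _) e => -[].
have [j _ mj] := injective_unbounded inj 0 m.
exists (pickle (prefix_of z m, j)) => // i im.
by rewrite /dense_node pickleK nth_mkseq ?(leq_trans im) // nth_mkseq.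
Qed.

(** The empty space is treated apart because it has no parametrisation. *)
Lemma s_imp_p (X : Type) (SX : set (set X)) (E : X -> X -> Prop) :
  standard_borel SX -> countable_borel_equivalence SX E ->
  prop_s SX E -> prop_p SX E.
Proof.
move=> hX hE hs phi hphi cphi; have sX := standard_borel_sigma hX.
have [[x0 _]|noX] := pselect (exists x : X, True); last first.
  have empty (P : X -> Prop) : SX [set x | P x].
    by apply: (borel_ext (SX := SX) (P := fun=> True)) (borel_const sX True) => x; case: noX; exists x.
  exists (fun=> Infset infinite_nat); last by move=> x; case: noX; exists x.
  split; last by move=> x; case: noX; exists x.
  by apply/(borel_map_infsetP sX) => k; apply: empty.
have [f hf] := standard_borel_param x0 hX.
have [[D [cD Dsec cover]]|emb] := sections_or_embedding sX hE hf hphi.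
  exact: (pseudointersection_of_sections sX hE hphi cphi cD Dsec cover).
have sz n : size (dense_node n) = n by apply: size_prefix.
have [V [V1 V2 V3 V4]] := emb dense_node sz.
by case: (splitting_no_embedding sX hE hf hphi hs sz dense_nodeP V1 V2 V3 V4).
Qed.

Theorem theorem7p1 (X : Type) (SX : set (set X)) (E : X -> X -> Prop)
    (hX : standard_borel SX) (hE : countable_borel_equivalence SX E) :
  (prop_s SX E -> prop_p SX E) /\
  (prop_p SX E -> prop_t SX E) /\
  (prop_p SX E -> prop_b SX E) /\
  (prop_p SX E -> prop_a SX E) /\
  (prop_b SX E -> prop_d SX E) /\
  (prop_b SX E -> prop_r SX E) /\
  (prop_r SX E -> prop_i SX E) /\
  (prop_r SX E -> prop_u SX E).
Proof.
have sX := standard_borel_sigma hX; have symE := @cber_sym _ _ _ hE.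
split; first exact: s_imp_p.
split; first exact: p_imp_t.
split; first exact: (p_imp_b sX symE).
split; first exact: (p_imp_a sX).
split; first exact: (b_imp_d sX).
split; first exact: (b_imp_r sX).
split; first exact: (r_imp_i sX symE).
exact: r_imp_u.
Qed.
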